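(* Let $X$ and $Z$ be nondegenerate observables on a $d$-dimensional Hilbert space $\mathcal H_A$ with orthonormal eigenbases $\{|\varphi_x\rangle\}_{x\in\mathsf X}$ and $\{|\theta_z\rangle\}_{z\in\mathsf Z}$. Let $\mathcal N:\mathcal B(\mathcal H_B)\to\mathcal B(\mathcal H_A)$ be a channel and $\mathcal N^\sharp:\mathcal B(\mathcal H_E)\to\mathcal B(\mathcal H_A)$ a complementary channel, with $\mathcal H_B,\mathcal H_E$ finite-dimensional. Suppose that there exists a measurement $\Lambda_X:L^\infty(\mathsf X)\to\mathcal B(\mathcal H_B)$ such that $\delta(\mathcal Q_X,\mathcal N\Lambda_X)\le\varepsilon$. Then there exists a constant channel $\mathcal C:\mathcal B(\mathcal H_E)\to\mathcal B(\mathcal H_A)$ such that $$\delta(\mathcal Q_Z^\natural\mathcal N^\sharp,\mathcal C)\le\sqrt{2\varepsilon}+\tfrac{d-1}{d}-\widehat c_P(X,Z).$$ For maximally complementary $X$ and $Z$, i.e. $|\langle\varphi_x|\theta_z\rangle|^2=\tfrac1d$ for all $x,z$, one has $\delta(\mathcal Q_Z^\natural\mathcal N^\sharp,\mathcal C)\le\sqrt{2\varepsilon}$.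
   Context: Heisenberg picture: a quantum channel is a completely positive unital linear map from the algebra of observables of the output system to that of the input system. A quantum system with Hilbert space $\mathcal H$ has algebra $\mathcal B(\mathcal H)$; a classical system with values in a finite set $\mathsf X$ has algebra $L^\infty(\mathsf X)$ (functions on $\mathsf X$). A measurement is a channel with purely classical output. Juxtaposition of channels is composition of maps: $(\mathcal E\mathcal F)(a)=\mathcal E(\mathcal F(a))$. Complementary channel: if $V:\mathcal H_A\to\mathcal H_B\otimes\mathcal H_E$ is a Stinespring isometry of $\mathcal N$, so $\mathcal N(b)=V^*(b\otimes\mathbb 1_E)V$, then $\mathcal N^\sharp(e)=V^*(\mathbb 1_B\otimes e)V$. Distinguishability: $\delta(\mathcal E_1,\mathcal E_2)=\tfrac12\|\mathcal E_1-\mathcal E_2\|_{\rm cb}$, where $\|T\|_{\rm cb}=\sup_{n\in\mathbb N}\|\mathrm{id}_n\otimes T\|_\infty$ and $\|\cdot\|_\infty$ is the norm of a linear map with respect to operator norms. $\mathcal Q_X:L^\infty(\mathsf X)\to\mathcal B(\mathcal H_A)$, $\mathcal Q_X(f)=\sum_xf(x)|\varphi_x\rangle\langle\varphi_x|$, is the ideal $X$ measurement. $\mathcal Q_Z^\natural:\mathcal B(\mathcal H_A)\to\mathcal B(\mathcal H_A)$, $\mathcal Q_Z^\natural(a)=\sum_z|\theta_z\rangle\langle\theta_z|a|\theta_z\rangle\langle\theta_z|$, is the pinching in the $Z$ basis. $\mathcal P_Z:\mathcal B(\mathcal H_A)\to L^\infty(\mathsf Z)$, $(\mathcal P_Z(a))(z)=\langle\theta_z|a|\theta_z\rangle$,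 is the ideal $Z$ preparation. A constant channel is one of the form $\mathcal C(a)=\sigma(a)\mathbb 1$ for a fixed state $\sigma$ on the output algebra. Complementarity measure: $\widehat c_P(X,Z)=\tfrac{d-1}{d}-\inf_{\mathcal C'}\delta(\mathcal C',\mathcal P_Z\mathcal Q_X)$, the infimum being over constant channels $\mathcal C':L^\infty(\mathsf X)\to L^\infty(\mathsf Z)$. *)

(* Defs.v *)
From HB Require Import structures.
From mathcomp Require Import all_boot all_order all_algebra.
From mathcomp.real_closed Require Import complex mxtens.
From mathcomp Require Import boolp classical_sets reals constructive_ereal ereal.

Set Implicit Arguments.
Unset Strict Implicit.
Unset Printing Implicit Defensive.

Import Order.TTheory GRing.Theory Num.Theory.
Local Open Scope ring_scope.
Local Open Scope sesquilinear_scope.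
Local Open Scope classical_set_scope.

(* L^oo(X) for a finite set X; the alias ^o makes the complex scalars a vector
   space over themselves. *)
Notation Linf R X := {ffun X -> R[i]^o}.

(* Finite-dimensional C*-algebras, presented as the unital *-algebra of matrices
   [range rep]. This determines the operator norm and the positive cone of every
   M_k(A). *)
HB.mixin Record isObsAlg (R : realType) A of GRing.Lmodule R[i] A := {
  repdim : nat;
  rep : A -> 'M[R[i]]_repdim;
  obs1 : A;
  rep_is_linear : linear rep;
  rep_inj : injective rep;
  rep1 : rep obs1 = 1%:M;
  rep_mul : forall a b, exists c, rep c = rep a *m rep b;
  rep_adj : forall a, exists b, rep b = (rep a)^t*
}.

#[short(type="obsAlgType")]
HB.structure Definition ObsAlg (R : realType) :=
  { A of isObsAlg R A & GRing.Lmodule R[i] A }.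

Arguments repdim {R} A : rename.
Arguments rep {R A} _ : rename.
Arguments obs1 {R A} : rename.

Section QuantumSystem.
Variables (R : realType) (n : nat).

Let qrep (a : 'M[R[i]]_n) : 'M[R[i]]_n := a.

Fact qrep_linear : linear qrep. Proof. by []. Qed.
Fact qrep_inj : injective qrep. Proof. by []. Qed.
Fact qrep1 : qrep 1%:M = 1%:M. Proof. by []. Qed.
Fact qrep_mul a b : exists c, qrep c = qrep a *m qrep b.
Proof. by exists (a *m b). Qed.
Fact qrep_adj a : exists b, qrep b = (qrep a)^t*.
Proof. by exists (a^t*). Qed.

HB.instance Definition _ := isObsAlg.Build R 'M[R[i]]_n
  qrep_linear qrep_inj qrep1 qrep_mul qrep_adj.
End QuantumSystem.

(* A classical observable acts on l^2(X) by multiplication. *)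
Section ClassicalSystem.
Variables (R : realType) (X : finType).

Definition mulop (f : Linf R X) : 'M[R[i]]_#|X| :=
  diag_mx (\row_i f (enum_val i)).

Fact mulop_linear : linear mulop.
Proof.
move=> c f g; apply/matrixP => i j.
by rewrite !mxE !ffunE mulrnDl mulrnAr.
Qed.

Fact mulop_inj : injective mulop.
Proof.
move=> f g /matrixP fg; apply/ffunP => x.
have := fg (enum_rank x) (enum_rank x).
by rewrite !mxE eqxx !mulr1n enum_rankK.
Qed.

Fact mulop1 : mulop [ffun=> 1] = 1%:M.
Proof. by apply/matrixP => i j; rewrite !mxE ffunE. Qed.

Fact mulop_mul f g : exists h, mulop h = mulop f *m mulop g.
Proof.
exists [ffun x => (f x : R[i]) * g x]; rewrite /mulop mulmx_diag.
by congr diag_mx; apply/rowP => i; rewrite !mxE ffunE.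
Qed.

Fact mulop_adj f : exists g, mulop g = (mulop f)^t*.
Proof.
exists [ffun x => (f x : R[i])^*]; apply/matrixP => i j.
rewrite !mxE ffunE eq_sym; case: eqP => [->|_]; first by rewrite !mulr1n.
by rewrite !mulr0n rmorph0.
Qed.

HB.instance Definition _ := isObsAlg.Build R (Linf R X)
  mulop_linear mulop_inj mulop1 mulop_mul mulop_adj.
End ClassicalSystem.

Section Channels.
Variable R : realType.
Local Notation C := R[i].

(* The order of C makes this positive semidefiniteness, Hermitian symmetry
   included. *)
Definition psdmx n (M : 'M[C]_n) : Prop :=
  forall v : 'cV[C]_n, 0 <= (v^t* *m M *m v) 0 0.

Definition l2norm n (v : 'cV[C]_n) : R :=
  Num.sqrt (complex.Re ((v^t* *m v) 0 0)).

Definition opnorm m n (M : 'M[C]_(m, n)) : \bar R :=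
  ereal_sup [set (l2norm (M *m v))%:E | v in [set v : 'cV[C]_n | l2norm v <= 1]].

(* An element of M_k(A), written as a k x k matrix over A, acts on the tensor
   product of C^k with the space on which A acts. *)
Definition mxrep (A : obsAlgType R) k (a : 'M[A]_k) : 'M[C]_(k * repdim A) :=
  \sum_i \sum_j (delta_mx i j *t rep (a i j)).

(* For T : A -> B, the map id_k (x) T : M_k(A) -> M_k(B) is [map_mx T]. *)
Definition completely_positive (A B : obsAlgType R) (T : A -> B) : Prop :=
  forall k (a : 'M[A]_k), psdmx (mxrep a) -> psdmx (mxrep (map_mx T a)).

Definition channel (A B : obsAlgType R) (T : A -> B) : Prop :=
  [/\ linear T, T obs1 = obs1 & completely_positive T].

Definition mapnorm (A B : obsAlgType R) k (S : 'M[A]_k -> 'M[B]_k) : \bar R :=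
  ereal_sup [set opnorm (mxrep (S a)) |
    a in [set a : 'M[A]_k | (opnorm (mxrep a) <= 1)%E]].

Definition cbnorm (A B : obsAlgType R) (T : A -> B) : \bar R :=
  ereal_sup [set mapnorm (fun a : 'M[A]_k => map_mx T a) | k in [set: nat]].

Definition delta (A B : obsAlgType R) (E1 E2 : A -> B) : \bar R :=
  ((2^-1)%R%:E * cbnorm (fun a => E1 a - E2 a)%R)%E.

Definition complementary dA dB dE
    (N : 'M[C]_dB -> 'M[C]_dA) (Nc : 'M[C]_dE -> 'M[C]_dA) : Prop :=
  exists V : 'M[C]_(dB * dE, dA),
    [/\ V^t* *m V = 1%:M,
        forall b, N b = V^t* *m (b *t (1%:M : 'M[C]_dE)) *m V &
        forall e, Nc e = V^t* *m ((1%:M : 'M[C]_dB) *t e) *m V].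

Definition state (A : obsAlgType R) (sigma : A -> C) : Prop :=
  [/\ linear (sigma : A -> C^o), sigma obs1 = 1 &
      forall a, psdmx (rep a) -> 0 <= sigma a].

Definition constant_channel (A B : obsAlgType R) (T : A -> B) : Prop :=
  channel T /\
  exists sigma : A -> C, state sigma /\ forall a, T a = sigma a *: obs1.

Definition orthonormal_basis d (I : finType) (e : I -> 'cV[C]_d) : Prop :=
  (forall i j, ((e i)^t* *m e j) 0 0 = (i == j)%:R) /\
  (forall v, exists c : I -> C, v = \sum_i c i *: e i).

Definition nondegenerate_eigenbasis d (I : finType)
    (H : 'M[C]_d) (e : I -> 'cV[C]_d) : Prop :=
  [/\ H \is hermsymmx,
      orthonormal_basis e &
      exists2 lambda : I -> R, injective lambda &
        forall i, H *m e i = (lambda i)%:C%C *: e i].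

Section IdealMaps.
Variables (d : nat) (I : finType) (e : I -> 'cV[C]_d).

Definition ideal_measurement (f : Linf R I) : 'M[C]_d :=
  \sum_i f i *: (e i *m (e i)^t*).

Definition pinching (a : 'M[C]_d) : 'M[C]_d :=
  \sum_i (e i *m (e i)^t*) *m a *m (e i *m (e i)^t*).

Definition ideal_preparation (a : 'M[C]_d) : Linf R I :=
  [ffun i => ((e i)^t* *m a *m e i) 0 0].
End IdealMaps.

Definition complementarity_P d (I J : finType)
    (phi : I -> 'cV[C]_d) (theta : J -> 'cV[C]_d) : \bar R :=
  (((d%:R - 1) / d%:R)%R%:E -
   ereal_inf [set delta T (ideal_preparation theta \o ideal_measurement phi) |
     T in [set T : Linf R I -> Linf R J | constant_channel T]])%E.

Definition maximally_complementary d (I J : finType)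
    (phi : I -> 'cV[C]_d) (theta : J -> 'cV[C]_d) : Prop :=
  forall x z, `| ((phi x)^t* *m theta z) 0 0 | ^+ 2 = (d%:R)^-1.

End Channels.

(* Main.v *)
(** Write [N b = V^* (b (x) 1) V], factor the effects of the measurement as
    [Lambda_x = A_x^* A_x], and put [T_x = (A_x (x) 1) V], so that
    [N Lambda_x = T_x^* T_x] and [Nc e = sum_x T_x^* (1 (x) e) T_x].  If some
    vectors [xi_x] of norm at most 1 satisfy
    [sum_x Re (<xi_x|T_x theta_z> <theta_z|phi_x>) >= 1 - eps] for every [z], then
    the states of E obtained from [sum_x |x> T_x theta_z] and from
    [sum_x |x> <phi_x|theta_z> xi_x] are [2 sqrt (2 eps)] close in norm.  The second
    is the mixture of the states of the [xi_x] with weights [|<phi_x|theta_z>|^2];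
    replacing these weights by a distribution [p] independent of [z] gives the
    constant channel, at the cost measured by the infimum in [c_P].

    Such [xi_x] exist by a minimax argument: it suffices to find, for every
    weight [lam] on the [z], vectors [xi_x] that satisfy the averaged inequality,
    whose best value is [sum_x |T_x rho phi_x|] with
    [rho = sum_z lam_z |theta_z><theta_z|].  This is bounded below by evaluating
    [id (x) (Q_X - N Lambda)] on a field of reflections [2 h_x h_x^* - 1]. *)

Require Import Defs.
From HB Require Import structures.
From mathcomp Require Import all_boot all_order all_algebra.
From mathcomp.real_closed Require Import complex mxtens.
From mathcomp Require Import boolp classical_sets reals constructive_ereal ereal.
From mathcomp Require Import topology normedtype derive.
From mathcomp Require Import ring lra.

Import Order.TTheory GRing.Theory Num.Theory.
Local Open Scope ring_scope.

Set Implicit Arguments.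
Unset Strict Implicit.
Unset Printing Implicit Defensive.

Import ComplexField.Normc.
Import numFieldNormedType.Exports.
Local Open Scope sesquilinear_scope.
Local Open Scope classical_set_scope.

(** * Inner products, Euclidean norms and operator norms *)

Lemma sum_CauchySchwarz (R : realType) (I : finType) (a b : I -> R) :
  \sum_i a i * b i <=
  Num.sqrt (\sum_i a i ^+ 2) * Num.sqrt (\sum_i b i ^+ 2).
Proof.
set A := \sum_i a i ^+ 2; set B := \sum_i b i ^+ 2; set S := \sum_i a i * b i.
have A0 : 0 <= A by apply: sumr_ge0 => i _; exact: sqr_ge0.
have B0 : 0 <= B by apply: sumr_ge0 => i _; exact: sqr_ge0.
have quad t : 0 <= A * t ^+ 2 - S * t *+ 2 + B.
  have -> : A * t ^+ 2 - S * t *+ 2 + B = \sum_i (a i * t - b i) ^+ 2.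
    rewrite /A /B /S !mulr_suml -sumrMnl -sumrB -big_split /=.
    by apply: eq_bigr => i _; rewrite sqrrB; ring.
  by apply: sumr_ge0 => i _; exact: sqr_ge0.
have : S ^+ 2 <= A * B.
  have [A_eq0|A_gt0] := eqVneq A 0.
    have S0 : S = 0.
      rewrite /S big1 // => i _; have /eqP := A_eq0.
      rewrite psumr_eq0 => [/allP/(_ i (mem_index_enum _))|j _]; last exact: sqr_ge0.
      by rewrite sqrf_eq0 => /eqP ->; rewrite mul0r.
    by rewrite S0 A_eq0 mul0r expr0n.
  have {}A_gt0 : 0 < A by rewrite lt_neqAle eq_sym A_gt0.
  (* The minimizer of the quadratic, where its value is [(A * B - S ^+ 2) / A]. *)
  have := quad (S / A).
  have -> : A * (S / A) ^+ 2 - S * (S / A) *+ 2 + B = (A * B - S ^+ 2) / A.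
    by field; rewrite gt_eqF.
  by rewrite pmulr_lge0 ?invr_gt0 // subr_ge0.
rewrite -sqrtrM // => leS; apply: le_trans (ler_norm S) _.
by rewrite -sqrtr_sqr ler_sqrt // mulr_ge0.
Qed.

Section Vectors.
Variable R : realType.
Local Notation C := R[i].

Definition cdot n (u v : 'cV[C]_n) : C := (u^t* *m v) 0 0.

Lemma cdotE n (u v : 'cV[C]_n) : cdot u v = \sum_i (u i 0)^* * v i 0.
Proof. by rewrite /cdot mxE; apply: eq_bigr => i _; rewrite !mxE. Qed.

Lemma cdotC n (u v : 'cV[C]_n) : cdot v u = (cdot u v)^*.
Proof.
rewrite !cdotE rmorph_sum; apply: eq_bigr => i _.
by rewrite rmorphM /= conjCK mulrC.
Qed.

Lemma cdot0r n (u : 'cV[C]_n) : cdot u 0 = 0.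
Proof. by rewrite /cdot mulmx0 mxE. Qed.

Lemma cdot0l n (u : 'cV[C]_n) : cdot 0 u = 0.
Proof. by rewrite cdotC cdot0r rmorph0. Qed.

Lemma cdotDr n (u v w : 'cV[C]_n) : cdot u (v + w) = cdot u v + cdot u w.
Proof. by rewrite /cdot mulmxDr mxE. Qed.

Lemma cdotBr n (u v w : 'cV[C]_n) : cdot u (v - w) = cdot u v - cdot u w.
Proof. by rewrite /cdot mulmxBr !mxE. Qed.

Lemma cdotDl n (u v w : 'cV[C]_n) : cdot (v + w) u = cdot v u + cdot w u.
Proof.
rewrite cdotC cdotDr rmorphD.
by congr (_ + _); symmetry; exact: cdotC.
Qed.

Lemma cdotBl n (u v w : 'cV[C]_n) : cdot (v - w) u = cdot v u - cdot w u.
Proof.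
rewrite cdotC cdotBr rmorphB.
by congr (_ - _); symmetry; exact: cdotC.
Qed.

Lemma cdotZr n a (u v : 'cV[C]_n) : cdot u (a *: v) = a * cdot u v.
Proof. by rewrite /cdot -scalemxAr mxE. Qed.

Lemma cdotZl n a (u v : 'cV[C]_n) : cdot (a *: u) v = a^* * cdot u v.
Proof. by rewrite cdotC cdotZr rmorphM /= -(cdotC v u). Qed.

Lemma cdot_sumr n (I : finType) (u : 'cV[C]_n) (F : I -> 'cV[C]_n) :
  cdot u (\sum_i F i) = \sum_i cdot u (F i).
Proof. by rewrite /cdot mulmx_sumr summxE. Qed.

Lemma cdot_suml n (I : finType) (u : 'cV[C]_n) (F : I -> 'cV[C]_n) :
  cdot (\sum_i F i) u = \sum_i cdot (F i) u.
Proof.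
by rewrite cdotC cdot_sumr rmorph_sum; apply: eq_bigr => i _; symmetry; exact: cdotC.
Qed.

Lemma adjmxM m n p (A : 'M[C]_(m, n)) (B : 'M[C]_(n, p)) :
  (A *m B)^t* = B^t* *m A^t*.
Proof. by rewrite trmx_mul map_mxM. Qed.

Lemma adjmx1 n : (1%:M : 'M[C]_n)^t* = 1%:M.
Proof. by rewrite trmx1 map_mx1. Qed.

Lemma adjmx_tens m n p q (A : 'M[C]_(m, n)) (B : 'M[C]_(p, q)) :
  (A *t B)^t* = A^t* *t B^t*.
Proof. by rewrite trmx_tens map_mxT. Qed.

Lemma adjmxK m n (A : 'M[C]_(m, n)) : A^t*^t* = A.
Proof. by apply/matrixP => i j; rewrite !mxE conjCK. Qed.

Lemma cdot_mulmx m n (A : 'M[C]_(m, n)) u v :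
  cdot u (A *m v) = cdot (A^t* *m u) v.
Proof. by rewrite /cdot adjmxM adjmxK mulmxA. Qed.

Lemma normc_sqr (z : C) : (normc z ^+ 2)%:C%C = z^* * z.
Proof. by rewrite mulrC -normCK rmorphXn. Qed.

Lemma conj_real (x : R) : (x%:C%C)^* = x%:C%C :> C.
Proof. exact: conjc_real. Qed.

Lemma normcJ (z : C) : normc z^* = normc z.
Proof. by apply: complexI; exact: norm_conjC. Qed.

Lemma normc_ge0 (z : C) : 0 <= normc z.
Proof. by rewrite -ler0c; exact: (normr_ge0 z). Qed.

Lemma normc_Re (z : C) : complex.Re z <= normc z.
Proof.
by case: z => a b /=; rewrite (le_trans (ler_norm a)) // -sqrtr_sqr
  ler_wsqrtr // lerDl sqr_ge0.
Qed.

Lemma normc_real (x : R) : normc x%:C%C = `|x|.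
Proof. by rewrite /= expr0n addr0 sqrtr_sqr. Qed.

Lemma normc_sum (I : finType) (F : I -> C) :
  normc (\sum_i F i) <= \sum_i normc (F i).
Proof.
elim/big_ind2: _ => [|x a y b xa yb|//]; first by rewrite normc0.
by apply: le_trans (le_normcD _ _) _; rewrite lerD.
Qed.

Lemma Re_sum (I : finType) (F : I -> C) :
  complex.Re (\sum_i F i) = \sum_i complex.Re (F i).
Proof. by apply: big_morph => // -[a b] [c d]. Qed.

Lemma cdot_real n (v : 'cV[C]_n) :
  cdot v v = (\sum_i normc (v i 0) ^+ 2)%:C%C.
Proof.
by rewrite cdotE rmorph_sum; apply: eq_bigr => i _; rewrite -normc_sqr.
Qed.

Lemma l2norm_sqr n (v : 'cV[C]_n) :
  l2norm v ^+ 2 = \sum_i normc (v i 0) ^+ 2.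
Proof.
rewrite /l2norm -/(cdot v v) cdot_real /= sqr_sqrtr //.
by apply: sumr_ge0 => i _; exact: sqr_ge0.
Qed.

Lemma cdotvv n (v : 'cV[C]_n) : cdot v v = (l2norm v ^+ 2)%:C%C.
Proof. by rewrite cdot_real l2norm_sqr. Qed.

Lemma l2norm_ge0 n (v : 'cV[C]_n) : 0 <= l2norm v.
Proof. exact: sqrtr_ge0. Qed.

Lemma l2norm_eq n (v : 'cV[C]_n) (a : R) :
  0 <= a -> cdot v v = (a ^+ 2)%:C%C -> l2norm v = a.
Proof.
by move=> a0 va; rewrite /l2norm -/(cdot v v) va /= sqrtr_sqr ger0_norm.
Qed.

Lemma l2norm0 n : l2norm (0 : 'cV[C]_n) = 0.
Proof. by apply: l2norm_eq => //; rewrite cdot0r expr0n. Qed.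

Lemma l2norm_eq0 n (v : 'cV[C]_n) : l2norm v = 0 -> v = 0.
Proof.
move=> v0; have /eqP := l2norm_sqr v; rewrite v0 expr0n eq_sym /=.
rewrite psumr_eq0 => [/allP vi|i _]; last exact: sqr_ge0.
apply/colP => i; have := vi i (mem_index_enum _).
by rewrite sqrf_eq0 mxE => /eqP/eq0_normc.
Qed.

Lemma l2normZ n a (v : 'cV[C]_n) : l2norm (a *: v) = normc a * l2norm v.
Proof.
apply: l2norm_eq; first by rewrite mulr_ge0 ?normc_ge0 ?l2norm_ge0.
by rewrite cdotZr cdotZl cdotvv mulrA [a * _]mulrC -normc_sqr -rmorphM exprMn.
Qed.

Lemma cdot_CauchySchwarz n (u v : 'cV[C]_n) :
  normc (cdot u v) <= l2norm u * l2norm v.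
Proof.
rewrite cdotE; apply: le_trans (normc_sum _) _.
have -> : l2norm u = Num.sqrt (\sum_i normc (u i 0) ^+ 2).
  by rewrite -l2norm_sqr sqrtr_sqr ger0_norm ?l2norm_ge0.
have -> : l2norm v = Num.sqrt (\sum_i normc (v i 0) ^+ 2).
  by rewrite -l2norm_sqr sqrtr_sqr ger0_norm ?l2norm_ge0.
apply: le_trans (sum_CauchySchwarz _ _).
by apply: ler_sum => i _; rewrite normcM normcJ.
Qed.

Lemma opnorm_bound m n (M : 'M[C]_(m, n)) (c : R) (v : 'cV[C]_n) :
  (opnorm M <= c%:E)%E -> l2norm (M *m v) <= c * l2norm v.
Proof.
move=> Mc; have [v0|v0] := eqVneq (l2norm v) 0.
  by rewrite v0 (l2norm_eq0 v0) mulmx0 l2norm0 mulr0.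
have v_gt0 : 0 < l2norm v by rewrite lt_neqAle eq_sym v0 l2norm_ge0.
pose w := (l2norm v)^-1%:C%C *: v.
have -> : v = (l2norm v)%:C%C *: w.
  by rewrite scalerA -rmorphM mulfV // scale1r.
rewrite -scalemxAr 2!l2normZ mulrCA ler_wpM2l ?normc_ge0 //.
have -> : l2norm w = 1.
  by rewrite l2normZ normc_real ger0_norm ?invr_ge0 ?l2norm_ge0 // mulVf.
rewrite mulr1 -lee_fin; apply: le_trans Mc; apply: ereal_sup_ubound.
exists w => //=.
by rewrite l2normZ normc_real ger0_norm ?invr_ge0 ?l2norm_ge0 // mulVf.
Qed.

(** Taking [u = M *m v] and dividing by [l2norm (M *m v)] recovers the norm from the form, so later
    estimates can work with sesquilinear forms only. *)
Lemma opnorm_le m n (M : 'M[C]_(m, n)) (c : R) : 0 <= c ->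
  (forall u v, normc (cdot u (M *m v)) <= c * (l2norm u * l2norm v)) ->
  (opnorm M <= c%:E)%E.
Proof.
move=> c0 Mc; apply: ge_ereal_sup => _ [v /= v1 <-]; rewrite lee_fin.
have [->//|Mv0] := eqVneq (l2norm (M *m v)) 0.
have := Mc (M *m v) v; rewrite cdotvv normc_real ger0_norm ?sqr_ge0 //.
rewrite expr2 mulrCA ler_pM2l; last by rewrite lt_neqAle eq_sym Mv0 l2norm_ge0.
by move/le_trans; apply; rewrite ler_piMr.
Qed.

Lemma opnorm_form m n (M : 'M[C]_(m, n)) (c : R) u v :
  (opnorm M <= c%:E)%E -> normc (cdot u (M *m v)) <= c * (l2norm u * l2norm v).
Proof.
move=> Mc; apply: le_trans (cdot_CauchySchwarz _ _) _.
by rewrite mulrCA ler_wpM2l ?l2norm_ge0 // opnorm_bound.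
Qed.

End Vectors.

(** * Tensor products and matrix amplifications *)

Section Tensors.
Variable R : realType.
Local Notation C := R[i].

Lemma sum_mxtens k n (F : 'I_(k * n) -> C) :
  \sum_r F r = \sum_(i < k) \sum_(p < n) F (mxtens_index (i, p)).
Proof.
rewrite pair_big /= (reindex (@mxtens_index k n)) /=; last first.
  by exists (@mxtens_unindex k n) => r _; rewrite (mxtens_indexK, mxtens_unindexK).
by apply: eq_bigr => -[i p].
Qed.

(** The component of [v] in the [i]-th copy of C^n inside C^k (x) C^n. *)
Definition blk k n (v : 'cV[C]_(k * n)) (i : 'I_k) : 'cV[C]_n :=
  \col_p v (mxtens_index (i, p)) 0.

Definition tensv k n (u : 'cV[C]_k) (w : 'cV[C]_n) : 'cV[C]_(k * n) :=
  \col_r (u (mxtens_unindex r).1 0 * w (mxtens_unindex r).2 0).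

Lemma blk_tensv k n (u : 'cV[C]_k) (w : 'cV[C]_n) i :
  blk (tensv u w) i = u i 0 *: w.
Proof. by apply/colP => p; rewrite !mxE mxtens_indexK. Qed.

Lemma blk_sum k n (I : finType) (F : I -> 'cV[C]_(k * n)) i :
  blk (\sum_x F x) i = \sum_x blk (F x) i.
Proof.
by apply/colP => p; rewrite mxE !summxE; apply: eq_bigr => x _; rewrite mxE.
Qed.

Lemma cdot_blk k n (u v : 'cV[C]_(k * n)) :
  cdot u v = \sum_i cdot (blk u i) (blk v i).
Proof.
rewrite cdotE sum_mxtens; apply: eq_bigr => i _.
by rewrite cdotE; apply: eq_bigr => p _; rewrite !mxE.
Qed.

Lemma l2norm_blk k n (v : 'cV[C]_(k * n)) :
  l2norm v ^+ 2 = \sum_i l2norm (blk v i) ^+ 2.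
Proof.
apply: complexI; rewrite -cdotvv cdot_blk rmorph_sum.
by apply: eq_bigr => i _; rewrite cdotvv.
Qed.

Lemma cdot_tensv k n (u u' : 'cV[C]_k) (w w' : 'cV[C]_n) :
  cdot (tensv u w) (tensv u' w') = cdot u u' * cdot w w'.
Proof.
rewrite cdot_blk (cdotE u) mulr_suml; apply: eq_bigr => i _.
by rewrite !blk_tensv cdotZl cdotZr mulrA.
Qed.

Lemma l2norm_tensv k n (u : 'cV[C]_k) (w : 'cV[C]_n) :
  l2norm (tensv u w) = l2norm u * l2norm w.
Proof.
apply: l2norm_eq; first by rewrite mulr_ge0 ?l2norm_ge0.
by rewrite cdot_tensv !cdotvv -rmorphM exprMn.
Qed.

Lemma blk_tens k l n p (A : 'M[C]_(k, l)) (B : 'M[C]_(n, p)) v i :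
  blk ((A *t B) *m v) i = B *m \sum_j A i j *: blk v j.
Proof.
apply/colP => q; rewrite !mxE sum_mxtens exchange_big /=.
apply: eq_bigr => r _; rewrite summxE mulr_sumr; apply: eq_bigr => j _.
by rewrite tensmxE !mxE mulrCA mulrA.
Qed.

(** [A (x) 1] commutes with [1 (x) a]. For an effect [A^* A] this absorbs the measurement into the
    isometry [V]. *)
Lemma tensmx_sandwich k n d (V : 'M[C]_(k * n, d)) (A : 'M[C]_k) (a : 'M[C]_n) :
  ((A *t 1%:M) *m V)^t* *m (1%:M *t a) *m ((A *t 1%:M) *m V) =
  V^t* *m ((A^t* *m A) *t a) *m V.
Proof.
transitivity (V^t* *m ((A^t* *t 1%:M) *m (1%:M *t a) *m (A *t 1%:M)) *m V).
  by rewrite adjmxM adjmx_tens adjmx1 !mulmxA.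
by rewrite !tensmx_mul mulmx1 mul1mx mulmx1.
Qed.

Lemma tensmx1 k n : (1%:M : 'M[C]_k) *t (1%:M : 'M[C]_n) = 1%:M.
Proof.
apply/matrixP => i j; case: (mxtens_indexP i) => i1 i2.
case: (mxtens_indexP j) => j1 j2.
by rewrite tensmxE !mxE (can_eq (@mxtens_indexK _ _)) xpair_eqE -natrM mulnb.
Qed.

(** Reduces norms and positivity in M_k(A) to the entries [rep (a i j)]: the matrix unit in each
    summand sends the block [j] to the block [i] and kills the others. *)
Lemma blk_mxrep (A : obsAlgType R) k (a : 'M[A]_k) v i :
  blk (mxrep a *m v) i = \sum_j rep (a i j) *m blk v j.
Proof.
rewrite /mxrep mulmx_suml blk_sum (bigD1 i) //= [X in _ + X]big1 ?addr0.
  rewrite mulmx_suml blk_sum; apply: eq_bigr => j _.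
  rewrite blk_tens (bigD1 j) //= [X in _ + X]big1 ?addr0 => [|l lj].
    by rewrite mxE !eqxx scale1r.
  by rewrite mxE (negPf lj) andbF scale0r.
move=> l li; rewrite mulmx_suml blk_sum big1 // => j _.
rewrite blk_tens big1 ?mulmx0 // => m _.
by rewrite mxE eq_sym (negPf li) scale0r.
Qed.

Lemma cdot_mxrep (A : obsAlgType R) k (a : 'M[A]_k) u v :
  cdot u (mxrep a *m v) =
  \sum_i \sum_j cdot (blk u i) (rep (a i j) *m blk v j).
Proof.
by rewrite cdot_blk; apply: eq_bigr => i _; rewrite blk_mxrep cdot_sumr.
Qed.

Lemma cdot_mxrep_tensv (A : obsAlgType R) k (a : 'M[A]_k) u v w w' :
  cdot (tensv u w) (mxrep a *m tensv v w') =
  \sum_i \sum_j (u i 0)^* * v j 0 * cdot w (rep (a i j) *m w').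
Proof.
rewrite cdot_mxrep; apply: eq_bigr => i _; apply: eq_bigr => j _.
by rewrite !blk_tensv -scalemxAr cdotZl cdotZr mulrA.
Qed.

Lemma psdmxP n (M : 'M[C]_n) : psdmx M <-> forall v, 0 <= cdot v (M *m v).
Proof. by split=> M0 v; have := M0 v; rewrite /cdot mulmxA. Qed.

Lemma psdmx_rep1 (A : obsAlgType R) (a : 'M[A]_1) :
  psdmx (mxrep a) <-> psdmx (rep (a 0 0)).
Proof.
split=> /psdmxP a0; apply/psdmxP => v; last by rewrite cdot_mxrep !big_ord1.
have := a0 (tensv (const_mx 1) v).
by rewrite cdot_mxrep_tensv !big_ord1 !mxE conjC1 !mul1r.
Qed.

Lemma opnorm_ge0 m n (M : 'M[C]_(m, n)) : (0 <= opnorm M)%E.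
Proof.
apply: ereal_sup_ubound; exists 0 => /=; first by rewrite l2norm0.
by rewrite mulmx0 l2norm0.
Qed.

Lemma mxrep0 (A : obsAlgType R) k : mxrep (0 : 'M[A]_k) = 0.
Proof.
have rep0 : rep (0 : A) = 0.
  by have := @rep_is_linear R A (-1) 0 0; rewrite scaler0 add0r scaleN1r addNr.
by rewrite /mxrep big1 // => i _; rewrite big1 // => j _; rewrite mxE rep0 tensmx0.
Qed.

Lemma opnorm_mxrep0 (A : obsAlgType R) k (c : R) : 0 <= c ->
  (opnorm (mxrep (0 : 'M[A]_k)) <= c%:E)%E.
Proof.
move=> c0; apply: opnorm_le => // u v.
by rewrite mxrep0 mul0mx cdot0r normc0 !mulr_ge0 ?l2norm_ge0.
Qed.

Lemma delta_ge0 (A B : obsAlgType R) (E F : A -> B) : (0 <= delta E F)%E.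
Proof.
rewrite /delta mule_ge0 //.
(* A supremum of extended reals is nonnegative once one term is; the zero matrix at level [k = 0]
   supplies it. *)
apply: le_trans (opnorm_ge0 (mxrep (map_mx (fun a => E a - F a) (0 : 'M_0)))) _.
apply: (@le_trans _ _ (mapnorm (fun a : 'M[A]_0 => map_mx (fun a => E a - F a) a))).
  by apply: ereal_sup_ubound; exists 0 => //=; exact: opnorm_mxrep0.
by apply: ereal_sup_ubound; exists 0.
Qed.

Lemma delta_opnorm (A B : obsAlgType R) (E F : A -> B) (c : R) k (a : 'M[A]_k) :
  (delta E F <= c%:E)%E -> (opnorm (mxrep a) <= 1)%E ->
  (opnorm (mxrep (map_mx (fun a => (E a - F a)%R) a)) <= (2 * c)%:E)%E.
Proof.
rewrite /delta => EFc a1; set D := fun a : A => _.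
have : (cbnorm D <= (2 * c)%:E)%E.
  by rewrite EFinM -lee_pdivrMl.
apply: le_trans; apply: (@le_trans _ _ (mapnorm (fun a : 'M[A]_k => map_mx D a))).
  by apply: ereal_sup_ubound; exists a.
by apply: ereal_sup_ubound; exists k.
Qed.

Lemma delta_le (A B : obsAlgType R) (E F : A -> B) (c : R) : 0 <= c ->
  (forall k (a : 'M[A]_k), (opnorm (mxrep a) <= 1)%E -> forall u v,
    normc (cdot u (mxrep (map_mx (fun a => E a - F a) a) *m v))
      <= 2 * c * (l2norm u * l2norm v)) ->
  (delta E F <= c%:E)%E.
Proof.
move=> c0 H; rewrite /delta lee_pdivrMl // -EFinM.
apply: ge_ereal_sup => _ [k _ <-]; apply: ge_ereal_sup => _ [a /= a1 <-].
by apply: opnorm_le; [rewrite mulr_ge0|exact: H].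
Qed.

End Tensors.

(** * Functionals given by families of vectors *)

Section Expectations.
Variable R : realType.
Local Notation C := R[i].

(** The norm of the vector sum_k |k> (x) alpha_k, for which the family stands. *)
Definition family_norm n (K : finType) (alpha : K -> 'cV[C]_n) : R :=
  Num.sqrt (\sum_k l2norm (alpha k) ^+ 2).

Lemma family_norm_sqr n (K : finType) (alpha : K -> 'cV[C]_n) :
  (family_norm alpha ^+ 2)%:C%C = \sum_k cdot (alpha k) (alpha k).
Proof.
rewrite sqr_sqrtr ?rmorph_sum; last by apply: sumr_ge0 => k _; exact: sqr_ge0.
by apply: eq_bigr => k _; rewrite cdotvv.
Qed.

Lemma family_norm_ge0 n (K : finType) (alpha : K -> 'cV[C]_n) :
  0 <= family_norm alpha.
Proof. exact: sqrtr_ge0. Qed.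

(** The functional a -> tr(a rho) with rho = sum_k |alpha_k><alpha_k|, a state when
    [family_norm alpha] is 1. *)
Definition vexp n (K : finType) (alpha : K -> 'cV[C]_n) (a : 'M[C]_n) : C :=
  \sum_k cdot (alpha k) (a *m alpha k).

Lemma vexp_linear n (K : finType) (alpha : K -> 'cV[C]_n) :
  linear (vexp alpha : 'M[C]_n -> C^o).
Proof.
move=> c a b; rewrite /vexp scaler_sumr -big_split /=.
by apply: eq_bigr => k _; rewrite mulmxDl -scalemxAl cdotDr cdotZr.
Qed.

Lemma vexp1 n (K : finType) (alpha : K -> 'cV[C]_n) :
  vexp alpha 1%:M = (family_norm alpha ^+ 2)%:C%C.
Proof.
by rewrite family_norm_sqr; apply: eq_bigr => k _; rewrite mul1mx.
Qed.

(** The matrix element <u| (id_k (x) f)(a) |v>. *)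
Definition amplify n k (f : 'M[C]_n -> C) (a : 'M['M[C]_n]_k) (u v : 'cV[C]_k) : C :=
  \sum_i \sum_j (u i 0)^* * v j 0 * f (a i j).

Lemma amplify_addsum n k (I : finType) (f g : 'M[C]_n -> C) (q : I -> C)
    (h : I -> 'M[C]_n -> C) (a : 'M['M[C]_n]_k) u v :
  (forall b, f b = g b + \sum_x q x * h x b) ->
  amplify f a u v = amplify g a u v + \sum_x q x * amplify (h x) a u v.
Proof.
move=> fE; transitivity (\sum_i \sum_j ((u i 0)^* * v j 0 * g (a i j) +
    \sum_x q x * ((u i 0)^* * v j 0 * h x (a i j)))).
  apply: eq_bigr => i _; apply: eq_bigr => j _; rewrite fE mulrDr mulr_sumr.
  by congr (_ + _); apply: eq_bigr => x _; rewrite mulrCA.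
under eq_bigr do rewrite big_split; rewrite big_split /=; congr (_ + _).
under eq_bigr do rewrite exchange_big; rewrite exchange_big.
apply: eq_bigr => x _; rewrite mulr_sumr; apply: eq_bigr => i _.
by rewrite mulr_sumr.
Qed.

Lemma amplify_vexp n k (K : finType) (alpha : K -> 'cV[C]_n) (a : 'M['M[C]_n]_k) u v :
  amplify (vexp alpha) a u v =
  \sum_x cdot (tensv u (alpha x)) (mxrep a *m tensv v (alpha x)).
Proof.
rewrite [RHS](eq_bigr _ (fun x _ => cdot_mxrep_tensv a u v (alpha x) (alpha x))).
rewrite [RHS]exchange_big; apply: eq_bigr => i _.
rewrite [RHS]exchange_big; apply: eq_bigr => j _.
by rewrite mulr_sumr.
Qed.

Section Contraction.
Variables (n k : nat) (a : 'M['M[C]_n]_k).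
Hypothesis a1 : (opnorm (mxrep a) <= 1)%E.

Let form_le x y : normc (cdot x (mxrep a *m y)) <= l2norm x * l2norm y.
Proof. by rewrite -[leRHS]mul1r; exact: opnorm_form. Qed.

Lemma family_form_le (K : finType) (alpha beta : K -> 'cV[C]_n) u v :
  normc (\sum_x cdot (tensv u (alpha x)) (mxrep a *m tensv v (beta x))) <=
  family_norm alpha * family_norm beta * (l2norm u * l2norm v).
Proof.
apply: le_trans (normc_sum _) _.
apply: (@le_trans _ _
  (\sum_x l2norm (alpha x) * l2norm (beta x) * (l2norm u * l2norm v))).
  apply: ler_sum => x _; apply: le_trans (form_le _ _) _.
  by rewrite !l2norm_tensv; lra.
rewrite -mulr_suml ler_wpM2r ?sum_CauchySchwarz //.
by rewrite mulr_ge0 ?l2norm_ge0.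
Qed.

Lemma amplify_vexp_le (K : finType) (alpha : K -> 'cV[C]_n) u v :
  normc (amplify (vexp alpha) a u v) <=
  family_norm alpha ^+ 2 * (l2norm u * l2norm v).
Proof. by rewrite amplify_vexp expr2 family_form_le. Qed.

Lemma tensvBr l m (u : 'cV[C]_l) (v w : 'cV[C]_m) :
  tensv u (v - w) = tensv u v - tensv u w.
Proof. by apply/colP => i; rewrite !mxE mulrBr. Qed.

(** Telescoping: the form at (alpha, alpha) minus the form at (beta, beta) is the form at (alpha -
    beta, alpha) plus the form at (beta, alpha - beta), and each term is bounded by Cauchy-Schwarz
    over the family. *)
Lemma amplify_vexp_sub_le (K : finType) (alpha beta : K -> 'cV[C]_n) u v :
  normc (amplify (fun e => vexp alpha e - vexp beta e) a u v) <=
  family_norm (fun x => alpha x - beta x) * (family_norm alpha + family_norm beta)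
    * (l2norm u * l2norm v).
Proof.
have -> : amplify (fun e => vexp alpha e - vexp beta e) a u v =
    \sum_x cdot (tensv u (alpha x - beta x)) (mxrep a *m tensv v (alpha x)) +
    \sum_x cdot (tensv u (beta x)) (mxrep a *m tensv v (alpha x - beta x)).
  have -> : amplify (fun e => vexp alpha e - vexp beta e) a u v =
      amplify (vexp alpha) a u v - amplify (vexp beta) a u v.
    rewrite /amplify -sumrB; apply: eq_bigr => i _; rewrite -sumrB.
    by apply: eq_bigr => j _; rewrite mulrBr.
  rewrite !amplify_vexp -sumrB -big_split; apply: eq_bigr => x _ /=.
  rewrite !tensvBr; move: (tensv u _) (tensv u _) (tensv v _) (tensv v _) => x1 x2 y1 y2.
  by rewrite mulmxBr cdotBl cdotBr; ring.
apply: le_trans (le_normcD _ _) _; rewrite mulrDr mulrDl lerD ?family_form_le //.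
by rewrite [X in _ <= X * _]mulrC family_form_le.
Qed.

End Contraction.

Lemma constant_channel_vexp n m (K : finType) (alpha : K -> 'cV[C]_n) :
  family_norm alpha = 1 ->
  constant_channel (fun e : 'M[C]_n => vexp alpha e *: (1%:M : 'M[C]_m)).
Proof.
move=> alpha1; have lin := vexp_linear alpha; split.
  split=> [c a b| |k a /psdmxP a0].
  - by rewrite lin scalerDl scalerA.
  - by rewrite /obs1 /= vexp1 alpha1 expr1n scale1r.
  apply/psdmxP => v; rewrite cdot_mxrep.
  (* Complete positivity: slicing [v] along the coordinates [p] of C^m turns the amplified form into
     a sum of values of the form of [a] on product vectors. *)
  rewrite (_ : \sum_i _ = \sum_p \sum_x
      cdot (tensv (\col_i blk v i p 0) (alpha x))
           (mxrep a *m tensv (\col_i blk v i p 0) (alpha x))).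
    by apply: sumr_ge0 => p _; apply: sumr_ge0 => x _; exact: a0.
  transitivity (\sum_p amplify (vexp alpha) a (\col_i blk v i p 0) (\col_i blk v i p 0)).
    rewrite /amplify [RHS]exchange_big; apply: eq_bigr => i _.
    rewrite [RHS]exchange_big; apply: eq_bigr => j _ /=.
    rewrite mxE [rep _](_ : _ = vexp alpha (a i j) *: 1%:M) //.
    rewrite -scalemxAl mul1mx cdotZr cdotE mulr_sumr; apply: eq_bigr => p _.
    by rewrite !mxE mulrC.
  by apply: eq_bigr => p _; rewrite amplify_vexp.
exists (vexp alpha); split=> //; split=> //.
  by rewrite /obs1 /= vexp1 alpha1 expr1n.
by move=> a /psdmxP a0; apply: sumr_ge0 => x _; exact: a0.
Qed.

End Expectations.

(** * Orthonormal bases and maps with diagonal values *)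

Section OrthonormalBasis.
Variables (R : realType) (d : nat) (I : finType).
Local Notation C := R[i].
Variable e : I -> 'cV[C]_d.
Hypothesis he : orthonormal_basis e.

Lemma onb_cdot i j : cdot (e i) (e j) = (i == j)%:R.
Proof. exact: he.1. Qed.

Lemma onb_expand v : v = \sum_i cdot (e i) v *: e i.
Proof.
have [c vE] := he.2 v; rewrite {1}vE; apply: eq_bigr => i _; congr (_ *: _).
rewrite vE cdot_sumr (bigD1 i) //= cdotZr onb_cdot eqxx mulr1 big1 ?addr0 //.
by move=> j ji; rewrite cdotZr onb_cdot eq_sym (negPf ji) mulr0.
Qed.

Lemma onb_cdot_expand u v : cdot u v = \sum_i cdot u (e i) * cdot (e i) v.
Proof.
rewrite {1}(onb_expand v) cdot_sumr; apply: eq_bigr => i _.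
by rewrite cdotZr mulrC.
Qed.

Lemma onb_l2norm v : l2norm v ^+ 2 = \sum_i normc (cdot (e i) v) ^+ 2.
Proof.
apply: complexI; rewrite -cdotvv onb_cdot_expand rmorph_sum; apply: eq_bigr => i _.
by rewrite (cdotC (e i) v); symmetry; exact: normc_sqr.
Qed.

Lemma l2norm_onb i : l2norm (e i) = 1.
Proof. by apply: l2norm_eq => //; rewrite onb_cdot eqxx expr1n. Qed.

Lemma projmx_mul i v : (e i *m (e i)^t*) *m v = cdot (e i) v *: e i.
Proof.
rewrite -mulmxA [(e i)^t* *m v]mx11_scalar -/(cdot _ _).
by apply/colP => j; rewrite !mxE big_ord1 !mxE eqxx mulr1n mulrC.
Qed.

Lemma sum_projmx : \sum_i e i *m (e i)^t* = 1%:M.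
Proof.
apply/matrixP => p q.
have := onb_expand (delta_mx q 0); move/colP/(_ p).
rewrite !mxE andbT => ->; rewrite !summxE; apply: eq_bigr => i _.
rewrite !mxE big_ord1 !mxE cdotE mulrC (bigD1 q) //= big1 ?addr0 => [|r rq].
  by rewrite !mxE !eqxx mulr1.
by rewrite !mxE (negPf rq) mulr0.
Qed.

Lemma cdot_mxrep_onb k n (g : I -> 'M[C]_n -> C)
  (D : 'M[C]_n -> 'M[C]_d) (a : 'M['M[C]_n]_k) u v :
  (forall b, D b = \sum_i g i b *: (e i *m (e i)^t*)) ->
  cdot u (mxrep (map_mx D a) *m v) =
  \sum_i amplify (g i) a (\col_l cdot (e i) (blk u l)) (\col_l cdot (e i) (blk v l)).
Proof.
move=> DE; rewrite cdot_mxrep /amplify [RHS]exchange_big; apply: eq_bigr => l _.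
rewrite [RHS]exchange_big; apply: eq_bigr => m _ /=.
rewrite mxE [rep _](_ : _ = D (a l m)) // DE mulmx_suml cdot_sumr.
apply: eq_bigr => i _; rewrite -scalemxAl projmx_mul !cdotZr !mxE.
by rewrite (cdotC (e i)) [RHS]mulrC [in RHS](mulrC _ (cdot _ (blk v m))).
Qed.

(** The amplified operator is block diagonal along [e]. A uniform bound on the blocks survives,
    since the slices of [u] and of [v] recombine by Cauchy-Schwarz over [i]. *)
Lemma mxrep_onb_le k n (g : I -> 'M[C]_n -> C) (D : 'M[C]_n -> 'M[C]_d)
  (a : 'M['M[C]_n]_k) (c : R) :
  (forall b, D b = \sum_i g i b *: (e i *m (e i)^t*)) ->
  0 <= c ->
  (forall i u v, normc (amplify (g i) a u v) <= c * (l2norm u * l2norm v)) ->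
  forall u v, normc (cdot u (mxrep (map_mx D a) *m v)) <= c * (l2norm u * l2norm v).
Proof.
move=> DE c0 gc u v; rewrite (cdot_mxrep_onb _ _ _ DE).
pose s (w : 'cV[C]_(k * d)) i : 'cV[C]_k := \col_l cdot (e i) (blk w l).
have normE w : l2norm w = Num.sqrt (\sum_i l2norm (s w i) ^+ 2).
  rewrite -[LHS]ger0_norm ?l2norm_ge0 // -sqrtr_sqr l2norm_blk; congr Num.sqrt.
  under eq_bigr do rewrite onb_l2norm.
  rewrite exchange_big; apply: eq_bigr => i _; rewrite l2norm_sqr.
  by apply: eq_bigr => l _; rewrite mxE.
apply: le_trans (normc_sum _) _.
apply: (@le_trans _ _ (\sum_i c * (l2norm (s u i) * l2norm (s v i)))).
  by apply: ler_sum => i _; exact: gc.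
by rewrite -mulr_sumr ler_wpM2l // !normE sum_CauchySchwarz.
Qed.

End OrthonormalBasis.

(** * Compactness, attained infima and an affine minimax principle *)

Section Compactness.
Variable R : realType.

Lemma continuous_sum (T : topologicalType) (I : finType) (F : I -> T -> R) :
  (forall i, continuous (F i)) -> continuous (fun x => \sum_i F i x).
Proof.
by move=> cF; apply: continuous_big => [|i _]; [exact: add_continuous|exact: cF].
Qed.

(** A closed subset of a compact box; both the products of unit balls and the probability simplex
    are presented in this form. *)
Lemma box_compact n (J : finType) (g : J -> 'rV[R]_n -> R) :
  (forall j, continuous (g j)) ->
  compact [set r : 'rV[R]_n | (forall i, `|r 0 i| <= 1) /\ forall j, g j r <= 0].
Proof.
move=> cg.
have box : compact [set r : 'rV[R]_n | forall i, `[(-1 : R), 1] (r ord0 i)].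
  by apply: (@rV_compact R n (fun=> `[(-1 : R), 1])) => _; exact: segment_compact.
apply: subclosed_compact box _; last first.
  by move=> r [r1 _] i; rewrite /= in_itv /= -ler_norml.
rewrite (_ : mkset _ = (\bigcap_i [set r : 'rV[R]_n | `|r 0 i| <= 1])
    `&` \bigcap_j [set r : 'rV[R]_n | g j r <= 0]); last first.
  by apply/seteqP; split=> r [r1 r2]; split=> // i; [move=> _; exact: r1
    |move=> _; exact: r2|exact: r1|exact: r2].
apply: closedI; apply: closed_bigI => i _.
  apply: (@preimage_closed _ _ (fun r : 'rV[R]_n => `|r 0 i|) [set x | x <= 1]).
    move=> r _; apply: continuous_comp; first exact: coord_continuous.
    exact: norm_continuous.
  exact: closed_le.
apply: (@preimage_closed _ _ (g i) [set x | x <= 0]); last exact: closed_le.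
by move=> r _; exact: cg.
Qed.

Lemma compact_argmin n (K : set 'rV[R]_n) (f : 'rV[R]_n -> R) :
  compact K -> K !=set0 -> continuous f ->
  exists2 r, K r & forall s, K s -> f r <= f s.
Proof.
move=> cK K0 cf; have [|r rK rmin] := EVT_min_rV K0 cK (f := f).
  exact: continuous_subspaceT.
by exists r => [|s sK]; [rewrite -inE|apply: rmin; rewrite inE].
Qed.

(** The sum [F] of twice the positive parts is nonnegative and takes arbitrarily small values on
    [K], so it vanishes at its minimizer. *)
Lemma compact_approx n (K : set 'rV[R]_n) (Z : finType) (f : Z -> 'rV[R]_n -> R) :
  compact K -> (forall z, continuous (f z)) ->
  (forall tau, 0 < tau -> exists2 r, K r & forall z, f z r <= tau) ->
  exists2 r, K r & forall z, f z r <= 0.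
Proof.
move=> cK cf apx; have [r0 Kr0 _] := apx 1 ltr01.
pose F r := \sum_z (`|f z r| + f z r).
have [||r Kr rmin] := compact_argmin (f := F) cK; first by exists r0.
  apply: continuous_sum => z r; exact: cvgD (cvg_norm (cf z r)) (cf z r).
have pos x : 0 <= `|x| + x :> R by have := ler_norm (- x); rewrite normrN; lra.
have small (e : R) : 0 < e -> F r <= e.
  (* The doubling matches the doubled positive part; the successor keeps the divisor nonzero when
     [Z] is empty. *)
  move=> e0; have N0 : 0 < #|Z|.*2.+1%:R :> R by rewrite ltr0n.
  have [|s Ks sle] := apx (e / #|Z|.*2.+1%:R); first by rewrite divr_gt0.
  apply: le_trans (rmin _ Ks) _.
  apply: (@le_trans _ _ (\sum_(z : Z) (e / #|Z|.*2.+1%:R) *+ 2)).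
    apply: ler_sum => z _; have := sle z; rewrite mulr2n.
    set q := e / _; have q0 : 0 < q by rewrite divr_gt0.
    case: (lerP 0 (f z s)) => [fz0 fz|/ltr0_norm ->]; first by rewrite ger0_norm // lerD.
    by rewrite addNr => _; rewrite addr_ge0 // ltW.
  rewrite sumr_const -mulrnA mul2n -[X in X <= _]mulr_natr mulrAC ler_pdivrMr // ler_pM2l //.
  by rewrite ler_nat.
have F0 : F r <= 0 by apply/ler_addgt0Pl => e e0; rewrite addr0; exact: small.
exists r => // z; have := F0; rewrite le_eqVlt ltNge sumr_ge0 // orbF.
rewrite psumr_eq0 // => /allP/(_ z (mem_index_enum _))/eqP.
by have := normr_ge0 (f z r); lra.
Qed.

Lemma affine_minimax n (K : set 'rV[R]_n) (Z : finType)
    (L : Z -> 'rV[R]_n -> R) (c : R) :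
  compact K -> (forall z, continuous (L z)) ->
  (forall r s t, K r -> K s -> 0 <= t <= 1 -> K (r + t *: (s - r))) ->
  (forall z r s t, L z (r + t *: (s - r)) = L z r + t * (L z s - L z r)) ->
  (forall lam : Z -> R, (forall z, 0 <= lam z) ->
    exists2 s, K s & c * \sum_z lam z <= \sum_z lam z * L z s) ->
  exists2 r, K r & forall z, c <= L z r.
Proof.
move=> cK cL convK affL H.
(* [p] is twice the positive part; the minimizer of the sum of the squares
   [p (c - L z r) ^+ 2] is optimal against the weights [p (c - L z r)]. *)
pose p x : R := `|x| + x.
have p_ge0 x : 0 <= p x.
  by rewrite /p; have := ler_norm (- x); rewrite normrN; lra.
have p_sqr x : p x * x = p x ^+ 2 / 2.
  rewrite /p; case: (lerP 0 x) => [/ger0_norm ->|/ltr0_norm ->]; first by field.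
  by rewrite addNr; field.
have p_step x y : p (x + y) ^+ 2 <= (p x + 2 * y) ^+ 2.
  rewrite /p; case: (lerP 0 (x + y)) => [/[dup] xy0 /ger0_norm ->|/ltr0_norm ->].
    by case: (lerP 0 x) => [/ger0_norm ->|/[dup] x0 /ltr0_norm ->]; nra.
  by rewrite addNr expr0n sqr_ge0.
pose F r := \sum_z p (c - L z r) ^+ 2.
(* The zero weight shows that [K] is nonempty. *)
have [s0 Ks0 _] := H (fun=> 0) (fun=> lexx _).
have [||r Kr rmin] := compact_argmin (f := F) cK; first by exists s0.
  apply: continuous_sum => z r.
  have cB : {for r, continuous (fun r => c - L z r)}.
    exact: cvgB (cvg_cst _) (cL z r).
  have cp : {for r, continuous (fun r => p (c - L z r))}.
    exact: cvgD (cvg_norm cB) cB.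
  exact: (cvgM cp cp).
pose lam z := p (c - L z r).
have [s Ks sge] := H lam (fun z => p_ge0 _).
pose k z := L z r - L z s.
set A := \sum_z lam z * k z; pose B := \sum_z k z ^+ 2.
have B0 : 0 <= B by apply: sumr_ge0 => z _; exact: sqr_ge0.
(* First-order optimality of [r] towards [s]: by [p_step], moving by [t] changes [F] by at most
   [4 * t * (A + t * B)]. *)
have AB t : 0 < t <= 1 -> 0 <= A + t * B.
  move=> /andP[t0 t1].
  have := rmin _ (convK r s t Kr Ks _); rewrite (ltW t0) t1 => /(_ isT).
  have : F (r + t *: (s - r)) <= F r + 4 * t * (A + t * B).
    rewrite /F /A /B mulrDr mulrA !mulr_sumr -!big_split; apply: ler_sum => z _ /=.
    rewrite affL (_ : c - _ = c - L z r + t * k z); last by rewrite /k; ring.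
    apply: le_trans (p_step _ _) _; rewrite -/(lam z) le_eqVlt; apply/orP; left.
    by apply/eqP; ring.
  move=> le1 le2; have : 0 <= t * (A + t * B) by lra.
  by rewrite pmulr_rge0.
have A0 : 0 <= A.
  rewrite leNgt; apply/negP => A_lt0.
  have D0 : 0 < 2 * (B - A + 1) by lra.
  (* If [A] were negative, this [t] would lie in (0, 1] and be small enough to keep [A + t * B]
     negative. *)
  have := AB (- A / (2 * (B - A + 1))).
  have -> : A + - A / (2 * (B - A + 1)) * B = A * (B - 2 * A + 2) / (2 * (B - A + 1)).
    by field; rewrite gt_eqF //; lra.
  have -> : 0 < - A / (2 * (B - A + 1)) <= 1.
    by rewrite divr_gt0 ?oppr_gt0 // ler_pdivrMr //; lra.
  by move=> /(_ isT); rewrite pmulr_lge0 ?invr_gt0 //; nra.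
(* [A0] and the choice of [s] give sum_z lam_z (c - L z r) <= 0, and by [p_sqr] each summand is half
   of [lam z ^+ 2]. *)
have lam0 : \sum_z lam z ^+ 2 <= 0.
  have : \sum_z lam z ^+ 2 = 2 * (c * \sum_z lam z - \sum_z lam z * L z r).
    rewrite mulr_sumr -sumrB mulr_sumr; apply: eq_bigr => z _.
    have := p_sqr (c - L z r); rewrite -/(lam z) => E.
    by rewrite [RHS](_ : _ = 2 * (lam z * (c - L z r))); [rewrite E; field|ring].
  move: A0; rewrite /A /k (eq_bigr (fun z => lam z * L z r - lam z * L z s)).
    by rewrite sumrB; lra.
  by move=> z _; rewrite mulrBr.
exists r => // z; have := lam0.
rewrite le_eqVlt ltNge sumr_ge0 => [|i _]; last exact: sqr_ge0.
rewrite orbF psumr_eq0 => [|i _]; last exact: sqr_ge0.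
move=> /allP/(_ z (mem_index_enum _)); rewrite sqrf_eq0 /lam /p => /eqP.
by have := normr_ge0 (c - L z r); lra.
Qed.

End Compactness.

(** * Reflections as contractive test elements over a classical algebra *)

Section Reflection.
Variable R : realType.
Local Notation C := R[i].

Lemma rep_mulop (X : finType) (f : Linf R X) (w : 'cV[C]_#|X|) p :
  (rep f *m w) p 0 = f (enum_val p) * w p 0.
Proof.
rewrite [rep f](_ : _ = mulop f) // /mulop mul_diag_mx !mxE //.
Qed.

Definition reflection_field (X : finType) k (h : X -> 'cV[C]_k) : 'M[Linf R X]_k :=
  \matrix_(i, j) [ffun x => 2 * (h x i 0 * (h x j 0)^*) - (i == j)%:R].

(** In the fibre over each point the element acts as w -> 2 <g|w> g - w, which preserves norms when
    [g] is a unit vector and is -1 when [g] is zero. *)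
Lemma opnorm_reflection_field (X : finType) k (h : X -> 'cV[C]_k) :
  (forall x, h x = 0 \/ l2norm (h x) = 1) ->
  (opnorm (mxrep (reflection_field h)) <= 1)%E.
Proof.
move=> h01; apply: opnorm_le => // u v; rewrite mul1r.
apply: le_trans (cdot_CauchySchwarz _ _) _; rewrite ler_wpM2l ?l2norm_ge0 //.
pose s (w : 'cV[C]_(k * #|X|)) p : 'cV[C]_k := \col_l blk w l p 0.
have normE w : l2norm w = Num.sqrt (\sum_p l2norm (s w p) ^+ 2).
  rewrite -[LHS]ger0_norm ?l2norm_ge0 // -sqrtr_sqr l2norm_blk; congr Num.sqrt.
  under eq_bigr do rewrite l2norm_sqr.
  rewrite exchange_big; apply: eq_bigr => p _; rewrite l2norm_sqr.
  by apply: eq_bigr => l _; rewrite [s w p l 0]mxE.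
rewrite (normE v) (normE (mxrep _ *m v)).
apply: ler_wsqrtr; apply: ler_sum => p _; set w := s v p; pose g := h (enum_val p).
have -> : s (mxrep (reflection_field h) *m v) p = (2 * cdot g w) *: g - w.
  apply/colP => i; rewrite mxE blk_mxrep summxE.
  transitivity (\sum_j (2 * g i 0 * ((g j 0)^* * w j 0) - (i == j)%:R * w j 0)).
    by apply: eq_bigr => j _; rewrite rep_mulop mxE ffunE !mxE /g; ring.
  rewrite sumrB -mulr_sumr -cdotE (bigD1 i) //= eqxx mul1r.
  rewrite big1 => [|j ji]; last by rewrite eq_sym (negPf ji) mul0r.
  rewrite addr0 [RHS]mxE [in RHS]mxE; congr (_ + _); last by rewrite [RHS]mxE.
  by rewrite mulrAC.
suff -> : l2norm ((2 * cdot g w) *: g - w) ^+ 2 = l2norm w ^+ 2 by [].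
apply: complexI; rewrite -[LHS]cdotvv -[RHS]cdotvv.
move: w g (h01 (enum_val p) : g = 0 \/ l2norm g = 1) => {}w {}g [g0|g1].
  by rewrite g0 scaler0 sub0r -scaleN1r cdotZl cdotZr rmorphN rmorph1; ring.
have gg : cdot g g = 1 by rewrite cdotvv g1 expr1n.
rewrite cdotBl !cdotBr !cdotZl !cdotZr gg (cdotC g w) rmorphM /=.
by rewrite [2^*]conjC_nat; ring.
Qed.

End Reflection.

Lemma sum_enum_val (V : nmodType) (I : finType) (F : I -> V) :
  \sum_i F i = \sum_(i < #|I|) F (enum_val i).
Proof. exact: reindex _ (onW_bij _ (@enum_val_bij I)). Qed.

(** * The lower bound on the averaged overlaps *)

Section Overlap.
Variables (R : realType) (d m : nat) (XX ZZ : finType).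
Local Notation C := R[i].
Variables (phi : XX -> 'cV[C]_d) (theta : ZZ -> 'cV[C]_d).
Hypotheses (hphi : orthonormal_basis phi) (htheta : orthonormal_basis theta).
Variables (E : Linf R XX -> 'M[C]_d) (T : XX -> 'M[C]_(m, d)) (eps : R).
Hypothesis EE : forall f, E f = \sum_x f x *: ((T x)^t* *m T x).
Hypothesis T1 : \sum_x (T x)^t* *m T x = 1%:M.
Hypothesis Eeps : (delta (ideal_measurement phi) E <= eps%:E)%E.

(** Applies rho = sum_z lam_z |theta_z><theta_z|, left unnormalized because the minimax principle
    uses arbitrary nonnegative weights. *)
Definition weighted (lam : ZZ -> R) (v : 'cV[C]_d) : 'cV[C]_d :=
  \sum_z ((lam z)%:C%C * cdot (theta z) v) *: theta z.

Lemma overlap_sum (lam : ZZ -> R) : (forall z, 0 <= lam z) ->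
  (1 - eps) * \sum_z lam z <= \sum_x l2norm (T x *m weighted lam (phi x)).
Proof.
move=> lam0.
pose D x := phi x *m (phi x)^t* - (T x)^t* *m T x.
have DE f : ideal_measurement phi f - E f = \sum_x f x *: D x.
  by rewrite EE -sumrB; apply: eq_bigr => x _; rewrite scalerBr.
have D1 : \sum_x D x = 0 by rewrite sumrB sum_projmx // T1 subrr.
pose r x := weighted lam (phi x).
pose n x : R := \sum_z lam z * normc (cdot (theta z) (phi x)) ^+ 2.
pose t x := l2norm (T x *m r x).
have n0 x : 0 <= n x by apply: sumr_ge0 => z _; rewrite mulr_ge0 ?sqr_ge0.
have t0 x : 0 <= t x by exact: l2norm_ge0.
have phir x : cdot (phi x) (r x) = (n x)%:C%C.
  rewrite cdot_sumr rmorph_sum; apply: eq_bigr => z _.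
  rewrite cdotZr -mulrA rmorphM /= normc_sqr (cdotC (theta z)).
  by rewrite [X in _ * X = _]mulrC.
have sum_n : \sum_x n x = \sum_z lam z.
  rewrite exchange_big; apply: eq_bigr => z _; rewrite -mulr_sumr.
  rewrite (eq_bigr (fun x => normc (cdot (phi x) (theta z)) ^+ 2)).
    by rewrite -onb_l2norm // (l2norm_onb htheta) expr1n mulr1.
  by move=> x _; rewrite (cdotC (phi x)) normcJ.
(* The test element is restricted to the [x] in [S], where [t x >= t x ^+ 2 / n x];
   elsewhere [t x >= n x] holds trivially. *)
pose S x := (0 < n x) && (t x <= n x).
pose k := #|ZZ|; pose th (i : 'I_k) := theta (enum_val i).
pose h x : 'cV[C]_k := if S x then
  \col_i ((Num.sqrt (lam (enum_val i) / n x))%:C%C * cdot (phi x) (th i)) else 0.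
have h01 x : h x = 0 \/ l2norm (h x) = 1.
  rewrite /h; case: ifP => [/andP[nx0 _]|_]; [right|by left].
  apply: l2norm_eq => //; rewrite cdot_real expr1n; congr (_%:C%C).
  transitivity (\sum_z lam z * normc (cdot (theta z) (phi x)) ^+ 2 / n x).
    rewrite [RHS]sum_enum_val; apply: eq_bigr => i _.
    rewrite mxE normcM exprMn normc_real real_normK ?num_real // sqr_sqrtr ?divr_ge0 //.
    by rewrite (cdotC (th i)) normcJ mulrAC.
  by rewrite -mulr_suml -/(n x) mulfV // gt_eqF.
(* The purification sum_z sqrt(lam_z) |z> (x) theta_z of rho. *)
pose Om : 'cV[C]_(k * d) := \col_q
  ((Num.sqrt (lam (enum_val (mxtens_unindex q).1)))%:C%C
    * th (mxtens_unindex q).1 (mxtens_unindex q).2 0).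
have blkO i : blk Om i = (Num.sqrt (lam (enum_val i)))%:C%C *: th i.
  by apply/colP => p; rewrite !mxE mxtens_indexK.
have normO : l2norm Om ^+ 2 = \sum_z lam z.
  rewrite l2norm_blk [RHS]sum_enum_val; apply: eq_bigr => i _.
  by rewrite blkO l2normZ (l2norm_onb htheta) mulr1 normc_real real_normK ?num_real //
    sqr_sqrtr.
have := opnorm_form Om Om (delta_opnorm Eeps (opnorm_reflection_field h01)).
(* The contraction of [Om] against [h x]. The choice of [h] makes it rho phi_x / sqrt(n x) on [S],
   and zero elsewhere. *)
pose b x : 'cV[C]_d := \sum_i ((Num.sqrt (lam (enum_val i)))%:C%C * (h x i 0)^*) *: th i.
have -> : cdot Om (mxrep (map_mx (fun f => ideal_measurement phi f - E f)
    (reflection_field h)) *m Om) = 2 * \sum_x cdot (b x) (D x *m b x).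
  rewrite cdot_mxrep mulr_sumr.
  transitivity (\sum_i \sum_j \sum_x 2 *
      (((Num.sqrt (lam (enum_val i)))%:C%C * (h x i 0)^*)^* *
       ((Num.sqrt (lam (enum_val j)))%:C%C * (h x j 0)^*) *
       cdot (th i) (D x *m th j))); last first.
    under eq_bigr do rewrite exchange_big; rewrite exchange_big.
    apply: eq_bigr => x _; rewrite /b cdot_suml mulr_sumr; apply: eq_bigr => i _.
    rewrite mulmx_sumr cdot_sumr mulr_sumr; apply: eq_bigr => j _.
    by rewrite cdotZl -scalemxAr cdotZr !mulrA.
  apply: eq_bigr => i _; apply: eq_bigr => j _.
  rewrite !blkO mxE [rep _](_ : _ =
    ideal_measurement phi (reflection_field h i j) - E (reflection_field h i j)) // DE.
  (* The -1 of the reflections drops out, because the [D x] sum to zero. *)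
  have -> : \sum_x reflection_field h i j x *: D x =
      \sum_x (2 * (h x i 0 * (h x j 0)^*)) *: D x.
    rewrite (eq_bigr (fun x =>
        (2 * (h x i 0 * (h x j 0)^*)) *: D x - (i == j)%:R *: D x)).
      by rewrite sumrB -scaler_sumr D1 scaler0 subr0.
    by move=> x _; rewrite mxE ffunE scalerBl.
  rewrite mulmx_suml cdot_sumr; apply: eq_bigr => x _.
  rewrite -scalemxAl -scalemxAr cdotZl !cdotZr rmorphM /= conjCK.
  by ring.
(* On [S] the left side equals t^2 / n, which is at most t since t <= n; off [S] it is just
   [n x]. *)
have Db x : n x - complex.Re (cdot (b x) (D x *m b x)) <= t x.
  rewrite /b /h; case: ifP => [/andP[nx0 tn]|/negbT nS]; last first.
    have -> : \sum_i ((Num.sqrt (lam (enum_val i)))%:C%C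
        * ((0 : 'cV[C]_k) i 0)^*) *: th i = 0.
      by rewrite big1 // => i _; rewrite mxE rmorph0 mulr0 scale0r.
    rewrite cdot0l /= subr0; move: nS; rewrite /S negb_and -leNgt -ltNge.
    by case/orP => [nle|/ltW //]; apply: le_trans nle (t0 x).
  have -> : \sum_i ((Num.sqrt (lam (enum_val i)))%:C%C * ((\col_i
      ((Num.sqrt (lam (enum_val i) / n x))%:C%C * cdot (phi x) (th i))) i 0)^*) *: th i
      = (Num.sqrt (n x)^-1)%:C%C *: r x.
    rewrite /r /weighted scaler_sumr [RHS]sum_enum_val; apply: eq_bigr => i _.
    rewrite scalerA mxE; congr (_ *: _).
    have sq : Num.sqrt (lam (enum_val i)) * Num.sqrt (lam (enum_val i) / n x)
        = Num.sqrt (n x)^-1 * lam (enum_val i).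
      by rewrite sqrtrM // mulrA -expr2 sqr_sqrtr // mulrC.
    rewrite (rmorphM Num.conj) /= conj_real (cdotC (phi x) (th i)).
    by rewrite mulrA [RHS]mulrA -!rmorphM sq.
  rewrite cdotZl -scalemxAr cdotZr mulmxBl cdotBr projmx_mul cdotZr phir.
  rewrite -mulmxA cdot_mulmx adjmxK cdotvv -/(t x) (cdotC (phi x)) phir.
  rewrite !conj_real -!rmorphM -rmorphB -!rmorphM.
  have ss : Num.sqrt (n x)^-1 * Num.sqrt (n x)^-1 = (n x)^-1.
    by rewrite -expr2 sqr_sqrtr // invr_ge0.
  change (n x - Num.sqrt (n x)^-1 * (Num.sqrt (n x)^-1 * (n x * n x - t x ^+ 2)) <= t x).
  rewrite mulrA ss (_ : _ - _ = t x * (t x / n x)); last by field; rewrite gt_eqF.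
  by rewrite ler_piMr // ler_pdivrMr // mul1r.
move=> le2.
have {}le2 : complex.Re (\sum_x cdot (b x) (D x *m b x)) <= eps * \sum_z lam z.
  have := le_trans (normc_Re _) le2; rewrite -expr2 normO.
  rewrite mulr_natl mulr2n; case: (\sum_x _) => u v /=; lra.
rewrite mulrBl mul1r -{1}sum_n; rewrite Re_sum in le2.
apply: le_trans (ler_sum _ (fun x _ => Db x)); rewrite sumrB; lra.
Qed.
End Overlap.

(** * Factorization of positive semidefinite matrices *)

Section SquareRoot.
Variable R : realType.
Local Notation C := R[i].

(** Polarization on delta_i + a delta_j: a = 1 makes [B] antisymmetric and a = i makes it
    symmetric. *)
Lemma cdot_form_eq0 n (B : 'M[C]_n) :
  (forall v, cdot v (B *m v) = 0) -> B = 0.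
Proof.
move=> B0.
have Bdelta i j : cdot (delta_mx i 0) (B *m delta_mx j 0) = B i j.
  rewrite cdotE (bigD1 i) //= big1 ?addr0 => [|l li].
    rewrite mxE !eqxx conjC1 mul1r mxE (bigD1 j) //= big1 ?addr0 => [|l lj].
      by rewrite mxE !eqxx mulr1.
    by rewrite mxE (negPf lj) mulr0.
  by rewrite mxE (negPf li) rmorph0 mul0r.
have polar a i j : a * B i j + a^* * B j i = 0.
  have := B0 (delta_mx i 0 + a *: delta_mx j 0).
  rewrite mulmxDr cdotDr !cdotDl -!scalemxAr !cdotZr !cdotZl !Bdelta.
  by rewrite -(Bdelta i i) -(Bdelta j j) !B0 !mulr0 add0r addr0 addrC.
apply/matrixP => i j; rewrite mxE.
have := polar 1 i j; have := polar 'i i j.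
rewrite conjC1 conjCi !mul1r mulNr -mulrBr => /eqP.
rewrite mulf_eq0 (negPf (neq0Ci _)) subr_eq0 => /eqP -> /eqP.
by rewrite -mulr2n mulrn_eq0 => /eqP.
Qed.

(** The form of [M] takes real values, so [M] and its adjoint have the same form. *)
Lemma psdmx_hermitian n (M : 'M[C]_n) : psdmx M -> M^t* = M.
Proof.
move=> /psdmxP M0; apply/eqP; rewrite -subr_eq0; apply/eqP/cdot_form_eq0 => v.
rewrite mulmxBl cdotBr cdot_mulmx adjmxK (cdotC v) conj_Creal ?subrr //.
exact: ger0_real.
Qed.

(** Take the square root of the diagonal part in the spectral decomposition; the eigenvalues are
    nonnegative as values of the form at eigenvectors. *)
Lemma psdmx_factor n (M : 'M[C]_n) :
  psdmx M -> exists A : 'M[C]_n, M = A^t* *m A.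
Proof.
move=> M0; have Mh := psdmx_hermitian M0.
have /orthomx_spectralP ME : M \is normalmx by apply/normalmxP; rewrite Mh.
set P := spectralmx M in ME; set sp := spectral_diag M in ME.
have PU : P \is unitarymx by exact: spectral_unitarymx.
have PPt : P *m P^t* = 1%:M by exact: unitarymxP.
rewrite (invmx_unitary PU) in ME.
have sp0 j : 0 <= sp 0 j.
  have /psdmxP/(_ (P^t* *m delta_mx j 0)) := M0.
  rewrite {1}ME -!mulmxA cdot_mulmx adjmxK (mulmxA P) PPt mul1mx.
  rewrite mul_diag_mx cdotE (bigD1 j) //= big1 ?addr0.
    by rewrite !mxE !eqxx conjC1 mul1r mulr1.
  by move=> l lj; rewrite !mxE (negPf lj) rmorph0 mul0r.
exists (diag_mx (\row_j sqrtC (sp 0 j)) *m P).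
rewrite adjmxM {1}ME -mulmxA -[RHS]mulmxA; congr (_ *m _).
rewrite [RHS]mulmxA; congr (_ *m _).
rewrite [(diag_mx _)^t*](_ : _ = diag_mx (\row_j sqrtC (sp 0 j))) ?mulmx_diag.
  by congr diag_mx; apply/rowP => j; rewrite !mxE -expr2 sqrtCK.
apply/matrixP => i j; rewrite !mxE eq_sym; case: eqP => [->|_].
  by rewrite !mulr1n conj_Creal // ger0_real // sqrtC_ge0.
by rewrite !mulr0n rmorph0.
Qed.

End SquareRoot.

(** * Effects of a measurement *)

Section Povm.
Variables (R : realType) (X : finType).
Local Notation C := R[i].

Definition indicator (x : X) : Linf R X := [ffun y => (y == x)%:R].

Lemma linear_indicator (V : lmodType C) (T : Linf R X -> V) (f : Linf R X) :
  linear T -> T f = \sum_x f x *: T (indicator x).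
Proof.
move=> linT; have T0 : T 0 = 0.
  by have := linT (-1) 0 0; rewrite scaler0 addr0 scaleN1r addNr.
have {1}-> : f = \sum_x (f x : C) *: indicator x.
  apply/ffunP => y; rewrite sum_ffunE (bigD1 y) //= big1 ?addr0 => [|x xy].
    by rewrite !ffunE eqxx [RHS]mulr1.
  by rewrite !ffunE eq_sym (negPf xy) [LHS]mulr0.
elim/big_rec2: _ => [//|x u v _ <-]; exact: linT.
Qed.

Lemma psdmx_indicator x : psdmx (rep (indicator x)).
Proof.
apply/psdmxP => v; rewrite cdotE; apply: sumr_ge0 => p _.
rewrite rep_mulop ffunE mulrCA -normc_sqr.
by rewrite mulr_ge0 ?ler0n // ler0c sqr_ge0.
Qed.

Lemma psdmx_channel_indicator n (Lam : Linf R X -> 'M[C]_n) x :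
  channel Lam -> psdmx (Lam (indicator x)).
Proof.
case=> _ _ /(_ 1%N (const_mx (indicator x))) cp.
suff /cp/psdmx_rep1 : psdmx (mxrep (const_mx (indicator x) : 'M_1)) by rewrite !mxE.
by apply/psdmx_rep1; rewrite mxE; exact: psdmx_indicator.
Qed.

Lemma sum_channel_indicator n (Lam : Linf R X -> 'M[C]_n) :
  channel Lam -> \sum_x Lam (indicator x) = 1%:M.
Proof.
case=> lin Lam1 _; have := linear_indicator obs1 lin; rewrite Lam1 => E.
by apply: etrans (esym E); apply: eq_bigr => x _; rewrite ffunE scale1r.
Qed.

End Povm.

(** * Minimax over a product of complex unit balls *)

Section BallMinimax.
Variables (R : realType) (XX ZZ : finType) (m : nat).
Local Notation C := R[i].

(** Real coordinates of a family of vectors of C^m: [false] marks real parts, [true] imaginary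
    parts. *)
Let I := (XX * 'I_m * bool)%type.
Let vec (r : 'rV[R]_#|{: I}|) x : 'cV[C]_m :=
  \col_i (r 0 (enum_rank (x, i, false)) +i* r 0 (enum_rank (x, i, true)))%C.

Let cvec (xi : XX -> 'cV[C]_m) : 'rV[R]_#|{: I}| :=
  \row_p let: (x, i, b) := enum_val p in
         if b then complex.Im (xi x i 0) else complex.Re (xi x i 0).

Let cvecK xi x : vec (cvec xi) x = xi x.
Proof. by apply/colP => i; rewrite !mxE !enum_rankK; case: (xi x i 0). Qed.

Let normc_sqrE (a b : R) : normc (a +i* b)%C ^+ 2 = a ^+ 2 + b ^+ 2.
Proof. by rewrite sqr_sqrtr // addr_ge0 ?sqr_ge0. Qed.

Let l2norm_vec r x : l2norm (vec r x) ^+ 2 =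
  \sum_i (r 0 (enum_rank (x, i, false)) ^+ 2 + r 0 (enum_rank (x, i, true)) ^+ 2).
Proof.
by rewrite l2norm_sqr; apply: eq_bigr => i _; rewrite mxE normc_sqrE.
Qed.

Let Re_cdot_vec r x (w : 'cV[C]_m) : complex.Re (cdot (vec r x) w) =
  \sum_i (r 0 (enum_rank (x, i, false)) * complex.Re (w i 0) +
          r 0 (enum_rank (x, i, true)) * complex.Im (w i 0)).
Proof.
rewrite cdotE Re_sum; apply: eq_bigr => i _; rewrite mxE.
by case: (w i 0) => a b /=; rewrite mulNr opprK.
Qed.

(** For fixed weights the best [xi x] in the unit ball is the normalized sum_z lam_z w x z, whose
    value is its norm; the hypothesis is thus the averaged condition of the affine minimax
    principle. *)
Lemma ball_minimax (w : XX -> ZZ -> 'cV[C]_m) (c : R) :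
  (forall lam : ZZ -> R, (forall z, 0 <= lam z) ->
    c * \sum_z lam z <= \sum_x l2norm (\sum_z (lam z)%:C%C *: w x z)) ->
  exists2 xi : XX -> 'cV[C]_m, forall x, l2norm (xi x) <= 1 &
    forall z, c <= \sum_x complex.Re (cdot (xi x) (w x z)).
Proof.
move=> H.
have coordC p : continuous (fun r : 'rV[R]_#|{: I}| => r 0 p).
  exact: coord_continuous.
pose L z (r : 'rV[R]_#|{: I}|) := \sum_x complex.Re (cdot (vec r x) (w x z)).
pose g x r := l2norm (vec r x) ^+ 2 - 1.
have cg x : continuous (g x).
  have cs : continuous (fun r : 'rV[R]_#|{: I}| => \sum_i
      (r 0 (enum_rank (x, i, false)) ^+ 2 + r 0 (enum_rank (x, i, true)) ^+ 2)).
    apply: continuous_sum => i r.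
    exact: (cvgD (cvgM (coordC _ r) (coordC _ r)) (cvgM (coordC _ r) (coordC _ r))).
  rewrite /g; under eq_fun do rewrite l2norm_vec.
  by move=> r; exact: (cvgB (cs r) (cvg_cst _)).
have cL z : continuous (L z).
  rewrite /L; under eq_fun do under eq_bigr do rewrite Re_cdot_vec.
  do 2!apply: continuous_sum => ?; move=> r.
  exact: (cvgD (cvgM (coordC _ r) (cvg_cst _)) (cvgM (coordC _ r) (cvg_cst _))).
have inK r : (forall x, l2norm (vec r x) <= 1) ->
    (forall p, `|r 0 p| <= 1) /\ forall x, g x r <= 0.
  move=> r1; have r1' x : l2norm (vec r x) ^+ 2 <= 1 by rewrite expr_le1 ?l2norm_ge0.
  split=> [p|x]; last by rewrite subr_le0.
  rewrite -[p]enum_valK; case: (enum_val p) => -[x i] b.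
  rewrite -(@expr_le1 _ 2) // real_normK ?num_real //; apply: le_trans (r1' x).
  rewrite l2norm_vec (bigD1 i) //= -[leLHS]addr0 lerD //; last first.
    by apply: sumr_ge0 => j _; rewrite addr_ge0 ?sqr_ge0.
  by case: b; [rewrite lerDr|rewrite lerDl]; exact: sqr_ge0.
have Kn r : (forall x, g x r <= 0) -> forall x, l2norm (vec r x) <= 1.
  by move=> gr x; have := gr x; rewrite subr_le0 expr_le1 ?l2norm_ge0.
have [r s t [_ Kr] [_ Ks] /andP[t0 t1]|z r s t|lam lam0|r [_ Kr] rL] :=
    affine_minimax (box_compact cg) (L := L) (c := c) cL.
- apply: inK => x; rewrite -(@expr_le1 _ 2) ?l2norm_ge0 //.
  have r1 : l2norm (vec r x) ^+ 2 <= 1 by rewrite -subr_le0; exact: Kr.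
  have s1 : l2norm (vec s x) ^+ 2 <= 1 by rewrite -subr_le0; exact: Ks.
  rewrite l2norm_vec in r1; rewrite l2norm_vec in s1; rewrite l2norm_vec.
  apply: (@le_trans _ _ ((1 - t) * 1 + t * 1)); last by lra.
  apply: le_trans (lerD (ler_wpM2l _ r1) (ler_wpM2l t0 s1)); last by lra.
  rewrite !mulr_sumr -big_split; apply: ler_sum => i _ /=; rewrite !mxE.
  set r1' := r 0 _; set r2' := r 0 _; set s1' := s 0 _; set s2' := s 0 _.
  have t1' : 0 <= 1 - t by rewrite subr_ge0.
  (* Convexity of the squared norm, whose exact defect is t (1 - t) |r - s|^2. *)
  have := mulr_ge0 (mulr_ge0 t0 t1')
    (addr_ge0 (sqr_ge0 (r1' - s1')) (sqr_ge0 (r2' - s2'))).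
  rewrite -subr_ge0 => /le_trans; apply; rewrite le_eqVlt; apply/orP; left.
  by apply/eqP; ring.
- rewrite /L mulrBr !mulr_sumr -sumrB -big_split; apply: eq_bigr => x _ /=.
  rewrite !Re_cdot_vec !mulr_sumr -sumrB -big_split; apply: eq_bigr => i _ /=.
  by rewrite !mxE; ring.
- pose y x := \sum_z (lam z)%:C%C *: w x z.
  (* If [y x] vanishes, the inverse is 0 by convention and [zeta x] is 0, which still lies in the
     ball. *)
  pose zeta x := (l2norm (y x))^-1%:C%C *: y x.
  exists (cvec zeta).
    apply: inK => x; rewrite cvecK l2normZ normc_real ger0_norm ?invr_ge0 ?l2norm_ge0 //.
    have [->|y0] := eqVneq (l2norm (y x)) 0; first by rewrite mulr0.
    by rewrite mulVf.
  apply: le_trans (H _ lam0) _; rewrite le_eqVlt; apply/orP; left; apply/eqP.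
  rewrite /L; under [RHS]eq_bigr do rewrite mulr_sumr.
  rewrite [RHS]exchange_big; apply: eq_bigr => x _ /=; rewrite -/(y x).
  transitivity (complex.Re (cdot (zeta x) (y x))).
    rewrite cdotZl cdotvv conj_real -rmorphM /=.
    have [->|y0] := eqVneq (l2norm (y x)) 0; first by rewrite expr0n mulr0.
    by rewrite expr2 mulrA mulVf // mul1r.
  rewrite /y cdot_sumr Re_sum; apply: eq_bigr => z _.
  rewrite cvecK cdotZr; case: (cdot _ _) => a b /=; by rewrite mul0r subr0.
- by exists (vec r); [exact: Kn|exact: rL].
Qed.

End BallMinimax.

(** * Constant classical channels as probability distributions *)

Section Distributions.
Variables (R : realType) (d : nat) (XX ZZ : finType).
Local Notation C := R[i].
Variables (phi : XX -> 'cV[C]_d) (theta : ZZ -> 'cV[C]_d).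

Definition born (x : XX) (z : ZZ) : R := normc (cdot (phi x) (theta z)) ^+ 2.

Definition distribution (p : XX -> R) : Prop :=
  (forall x, 0 <= p x) /\ \sum_x p x = 1.

Lemma born_distribution z :
  orthonormal_basis phi -> orthonormal_basis theta -> distribution (born^~ z).
Proof.
move=> hphi htheta; split=> [x|]; first exact: sqr_ge0.
by rewrite -onb_l2norm // l2norm_onb // expr1n.
Qed.

Lemma preparation_measurementE (f : Linf R XX) z :
  ideal_preparation theta (ideal_measurement phi f) z =
  \sum_x f x * (born x z)%:C%C.
Proof.
rewrite ffunE -mulmxA -/(cdot _ _) mulmx_suml cdot_sumr; apply: eq_bigr => x _.
rewrite -scalemxAl projmx_mul !cdotZr; congr (_ * _).
by rewrite (cdotC (phi x) (theta z)) normc_sqr mulrC.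
Qed.

(** A state on L^oo(X) is a distribution, and testing the difference of the channels on a function
    with values 1 and -1 yields the l^1 distance between the distributions at each [z]. *)
Lemma constant_channel_distribution (T : Linf R XX -> Linf R ZZ) (c : R) :
  constant_channel T ->
  (delta T (ideal_preparation theta \o ideal_measurement phi) <= c%:E)%E ->
  exists2 p, distribution p & forall z, \sum_x `|born x z - p x| <= 2 * c.
Proof.
move=> [_ [sigma [[lin s1 s0] TE]]] Tc.
pose p x := complex.Re (sigma (indicator R x)).
have pE x : sigma (indicator R x) = (p x)%:C%C.
  by rewrite RRe_real // ger0_real // s0 //; exact: psdmx_indicator.
have sigmaE f : sigma f = \sum_x f x * (p x)%:C%C.
  by rewrite (linear_indicator f lin); apply: eq_bigr => x _; rewrite pE.
exists p => [|z].
  split=> [x|]; first by rewrite -ler0c -pE s0 //; exact: psdmx_indicator.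
  apply: complexI; rewrite rmorph_sum rmorph1 -s1 sigmaE.
  by apply: eq_bigr => x _; rewrite ffunE mul1r.
(* For [k = 1] the reflection field is scalar: this [h] makes it the sign of [p x - born x z]. *)
pose h x : 'cV[C]_1 := if born x z <= p x then const_mx 1 else 0.
have h01 x : h x = 0 \/ l2norm (h x) = 1.
  rewrite /h; case: ifP => _; [right|by left].
  by apply: l2norm_eq => //; rewrite cdotE big_ord1 !mxE conjC1 mulr1 expr1n.
pose v : 'cV[C]_(1 * #|ZZ|) := tensv (const_mx 1) (delta_mx (enum_rank z) 0).
have v1 : l2norm v = 1.
  apply: l2norm_eq => //; rewrite cdot_tensv !cdotE big_ord1 !mxE conjC1 mul1r.
  rewrite (bigD1 (enum_rank z)) //= big1 ?addr0 => [|i iz].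
    by rewrite !mxE !eqxx conjC1 !mul1r expr1n.
  by rewrite !mxE (negPf iz) mulr0.
have := opnorm_form v v (delta_opnorm Tc (opnorm_reflection_field h01)).
rewrite v1 !mulr1 cdot_mxrep_tensv !big_ord1 !mxE conjC1 !mul1r.
set f := [ffun x => _]; rewrite cdotE (bigD1 (enum_rank z)) //= big1 ?addr0; last first.
  by move=> i iz; rewrite mxE (negPf iz) rmorph0 mul0r.
rewrite rep_mulop mxE !eqxx conjC1 mul1r mulr1 enum_rankK.
have -> : (T f - (ideal_preparation theta \o ideal_measurement phi) f) z =
    \sum_x f x * (p x - born x z)%:C%C.
  rewrite (eq_bigr (fun x => f x * (p x)%:C%C - f x * (born x z)%:C%C)) => [|x _].
    rewrite sumrB -sigmaE -preparation_measurementE TE !ffunE; congr (_ - _).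
    exact: mulr1.
  by rewrite rmorphB mulrBr.
move/(le_trans (normc_Re _)); apply: le_trans; rewrite le_eqVlt; apply/orP; left.
apply/eqP; rewrite Re_sum; apply: eq_bigr => x _.
rewrite ffunE /h; case: ifP => [le_p|/negbT]; rewrite !mxE.
  rewrite conjC1 eqxx !mulr1 (_ : 2 - 1 = 1) ?mul1r; last by ring.
  by rewrite distrC ger0_norm ?subr_ge0.
rewrite -ltNge => p_lt; rewrite mul0r mulr0 sub0r eqxx mulN1r -rmorphN.
by rewrite opprB gtr0_norm ?subr_gt0.
Qed.

(** Channels within tau / 2 of the infimum give distributions within tau of the bound, and
    compactness of the simplex lets tau reach 0. *)
Lemma best_distribution (c : R) :
  ereal_inf [set delta T (ideal_preparation theta \o ideal_measurement phi) |
    T in [set T : Linf R XX -> Linf R ZZ | constant_channel T]] = c%:E ->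
  exists2 p, distribution p & forall z, \sum_x `|born x z - p x| <= 2 * c.
Proof.
move=> inf_c.
pose val (r : 'rV[R]_#|XX|) x := r 0 (enum_rank x).
have valC x : continuous (val^~ x) by exact: coord_continuous.
have sumC : continuous (fun r => \sum_x val r x) by exact: continuous_sum.
pose g (j : XX + bool) (r : 'rV[R]_#|XX|) : R := match j with
  | inl x => 0 - val r x
  | inr b => if b then \sum_x val r x - 1 else 1 - \sum_x val r x end.
have cg j : continuous (g j).
  case: j => [x|[]] r; [exact: (cvgB (cvg_cst _) (valC x r))|
    exact: (cvgB (sumC r) (cvg_cst _))|exact: (cvgB (cvg_cst _) (sumC r))].
pose f z r := \sum_x `|born x z - val r x| - 2 * c.
have cf z : continuous (f z).
  have cs : continuous (fun r => \sum_x `|born x z - val r x|).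
    by apply: continuous_sum => x r; exact: (cvg_norm (cvgB (cvg_cst _) (valC x r))).
  by move=> r; exact: (cvgB (cs r) (cvg_cst _)).
have [tau tau0|r [_ gr] fr] := compact_approx (box_compact cg) cf.
  have fin : ereal_inf [set delta T (ideal_preparation theta \o ideal_measurement phi) |
      T in [set T : Linf R XX -> Linf R ZZ | constant_channel T]] \is a fin_num.
    by rewrite inf_c.
  have t2 : 0 < tau / 2 by rewrite divr_gt0.
  have [_ [T cT <-] /ltW] := lb_ereal_inf_adherent t2 fin.
  rewrite inf_c -EFinD => /(constant_channel_distribution cT)[p [p0 p1] ple].
  have valp x : val (\row_i p (enum_val i)) x = p x by rewrite /val mxE enum_rankK.
  have sump : \sum_x val (\row_i p (enum_val i)) x = 1.
    by rewrite -p1; apply: eq_bigr => x _.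
  exists (\row_i p (enum_val i)).
    split=> [i|[x|[]]]; rewrite /g ?valp ?sump ?subrr ?sub0r ?oppr_le0 //.
    rewrite mxE ger0_norm // -p1 (bigD1 (enum_val i)) //= lerDl.
    by apply: sumr_ge0 => x _.
  move=> z; rewrite /f; under eq_bigr do rewrite valp.
  by have := ple z; lra.
exists (val r) => [|z]; last by have := fr z; rewrite /f subr_le0.
split=> [x|]; first by have := gr (inl x); rewrite /g; lra.
by have := gr (inr true); have := gr (inr false); rewrite /g; lra.
Qed.

End Distributions.

(** * Completing a vector of B (x) E to a family of prescribed norm *)

Section ExtendedFamily.
Variables (R : realType) (b n : nat).
Local Notation C := R[i].

(* The slot [ord0] holds a vector that makes up for the missing norm of [xi]. *)
Definition extend (xi : 'cV[C]_(b * n)) (eta : 'cV[C]_n) (j : 'I_b.+1) : 'cV[C]_n :=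
  oapp (blk xi) eta (unlift ord0 j).

Lemma sum_extend (a : 'M[C]_n) xi eta xi' eta' :
  \sum_j cdot (extend xi eta j) (a *m extend xi' eta' j) =
  cdot eta (a *m eta') + \sum_i cdot (blk xi i) (a *m blk xi' i).
Proof.
rewrite big_ord_recl /extend unlift_none /=; congr (_ + _).
by apply: eq_bigr => i _; rewrite liftK.
Qed.

Lemma sum_cdot_extend xi eta xi' eta' :
  \sum_j cdot (extend xi eta j) (extend xi' eta' j) = cdot eta eta' + cdot xi xi'.
Proof.
have := sum_extend 1%:M xi eta xi' eta'; rewrite mul1mx.
rewrite (eq_bigr (fun j => cdot (extend xi eta j) (extend xi' eta' j))) => [->|j _].
  by rewrite cdot_blk; congr (_ + _); apply: eq_bigr => i _; rewrite mul1mx.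
by rewrite mul1mx.
Qed.

End ExtendedFamily.

Lemma projmx_sandwich (R : realType) d (e : 'cV[R[i]]_d) (a : 'M[R[i]]_d) :
  (e *m e^t*) *m a *m (e *m e^t*) = cdot e (a *m e) *: (e *m e^t*).
Proof.
transitivity (e *m (e^t* *m (a *m e)) *m e^t*); first by rewrite !mulmxA.
by rewrite [e^t* *m _]mx11_scalar mul_mx_scalar -scalemxAl.
Qed.

(** * Approximating the pinched complementary channel by a constant one *)

Section ConstantApproximation.
Variables (R : realType) (d dB dE : nat) (XX ZZ : finType).
Local Notation C := R[i].
Variables (phi : XX -> 'cV[C]_d) (theta : ZZ -> 'cV[C]_d).
Hypotheses (hphi : orthonormal_basis phi) (htheta : orthonormal_basis theta).
Variables (Nc : 'M[C]_dE -> 'M[C]_d) (T : XX -> 'M[C]_(dB * dE, d)).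
Hypothesis NcE : forall e, Nc e = \sum_x (T x)^t* *m ((1%:M : 'M_dB) *t e) *m T x.
Hypothesis T1 : \sum_x (T x)^t* *m T x = 1%:M.
Hypothesis dE_gt0 : (0 < dE)%N.

Lemma constant_channel_approx (eps b : R) (xi : XX -> 'cV[C]_(dB * dE)) (p : XX -> R) :
  (forall x, l2norm (xi x) <= 1) ->
  (forall z, 1 - eps <=
     \sum_x complex.Re (cdot (xi x) (cdot (theta z) (phi x) *: (T x *m theta z)))) ->
  distribution p -> 0 <= b ->
  (forall z, \sum_x `|born phi theta x z - p x| <= 2 * b) ->
  exists2 S : 'M[C]_dE -> 'M[C]_d, constant_channel S &
    (delta (pinching theta \o Nc) S <= (Num.sqrt (2 * eps) + b)%:E)%E.
Proof.
move=> xi1 xiT [p0 p1] b0 pb.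
pose eta : 'cV[C]_dE := delta_mx (Ordinal dE_gt0) 0.
have eta1 : cdot eta eta = 1.
  rewrite cdotE (bigD1 (Ordinal dE_gt0)) //= big1 ?addr0 => [|i i0].
    by rewrite !mxE !eqxx conjC1 mul1r.
  by rewrite mxE (negPf i0) rmorph0 mul0r.
pose s x := Num.sqrt (1 - l2norm (xi x) ^+ 2).
(* Padding [xi x] to norm exactly 1, so that mixtures of the [vexp (xi' x)] are states. *)
pose xi' x : 'I_dB.+1 -> 'cV[C]_dE := extend (xi x) ((s x)%:C%C *: eta).
have xi'1 x : family_norm (xi' x) = 1.
  apply/eqP; rewrite -sqrp_eq1 ?family_norm_ge0 //; apply/eqP/complexI.
  rewrite family_norm_sqr sum_cdot_extend cdotZl cdotZr eta1 mulr1 cdotvv conj_real.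
  rewrite -rmorphM -rmorphD -expr2 sqr_sqrtr ?subrK //.
  by rewrite subr_ge0 expr_le1 ?l2norm_ge0.
pose K := (XX * 'I_dB.+1)%type.
(* [gam] yields the constant state, [al z] the functional e -> <theta_z|Nc e|theta_z>, and [be z]
   the mixture with weights [born]. The second index traces out B. *)
pose gam (k : K) := (Num.sqrt (p k.1))%:C%C *: xi' k.1 k.2.
pose al z (k : K) : 'cV[C]_dE := extend (T k.1 *m theta z) 0 k.2.
pose be z (k : K) := cdot (phi k.1) (theta z) *: xi' k.1 k.2.
have vexp_gam e : vexp gam e = \sum_x (p x)%:C%C * vexp (xi' x) e.
  rewrite /vexp -(pair_bigA _ (fun x j => cdot (gam (x, j)) (e *m gam (x, j)))) /=.
  apply: eq_bigr => x _; rewrite mulr_sumr; apply: eq_bigr => j _.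
  rewrite /gam /= -scalemxAr cdotZl cdotZr conj_real mulrA -rmorphM -expr2.
  by rewrite sqr_sqrtr.
have vexp_be z e : vexp (be z) e = \sum_x (born phi theta x z)%:C%C * vexp (xi' x) e.
  rewrite /vexp -(pair_bigA _ (fun x j => cdot (be z (x, j)) (e *m be z (x, j)))) /=.
  apply: eq_bigr => x _; rewrite mulr_sumr; apply: eq_bigr => j _.
  by rewrite /be /= -scalemxAr cdotZl cdotZr mulrA -normc_sqr.
have vexp_al z e : vexp (al z) e = cdot (theta z) (Nc e *m theta z).
  rewrite NcE mulmx_suml cdot_sumr.
  rewrite /vexp -(pair_bigA _ (fun x j => cdot (al z (x, j)) (e *m al z (x, j)))) /=.
  apply: eq_bigr => x _; rewrite /al /= sum_extend mulmx0 cdot0r add0r.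
  rewrite -!mulmxA cdot_mulmx adjmxK [RHS]cdot_blk; apply: eq_bigr => i _.
  rewrite blk_tens; congr (cdot _ (_ *m _)).
  rewrite (bigD1 i) //= big1 ?addr0 => [|j ji]; first by rewrite mxE eqxx scale1r.
  by rewrite mxE eq_sym (negPf ji) scale0r.
have family_norm1 (alpha : K -> 'cV[C]_dE) : vexp alpha 1%:M = 1 -> family_norm alpha = 1.
  rewrite vexp1 => /complexI/eqP; rewrite sqrp_eq1 ?family_norm_ge0 //.
  by move/eqP.
have sum1 (q : XX -> R) : distribution q -> \sum_x (q x)%:C%C * vexp (xi' x) 1%:M = 1.
  move=> [_ q1]; transitivity ((\sum_x q x)%:C%C : C); last by rewrite q1.
  rewrite rmorph_sum; by apply: eq_bigr => x _; rewrite vexp1 xi'1 expr1n mulr1.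
have gam1 : family_norm gam = 1 by apply: family_norm1; rewrite vexp_gam sum1.
have be1 z : family_norm (be z) = 1.
  by apply: family_norm1; rewrite vexp_be sum1 //; exact: born_distribution.
have al1 z : family_norm (al z) = 1.
  apply: family_norm1; rewrite vexp_al NcE.
  rewrite (eq_bigr (fun x => (T x)^t* *m T x)) => [|x _].
    by rewrite T1 mul1mx cdotvv l2norm_onb // expr1n.
  by rewrite tensmx1 mulmx1.
(* Both families have norm 1, so the squared distance is 2 - 2 Re <be|al>. The padding slot adds
   nothing to the overlap, as [al] is zero there. *)
have close z : family_norm (fun k => al z k - be z k) <= Num.sqrt (2 * eps).
  rewrite -[leLHS]ger0_norm ?family_norm_ge0 // -sqrtr_sqr ler_wsqrtr //.
  have -> : family_norm (fun k => al z k - be z k) ^+ 2 =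
      family_norm (al z) ^+ 2 + family_norm (be z) ^+ 2 -
      complex.Re (\sum_k cdot (be z k) (al z k)) *+ 2.
    apply: complexI; rewrite family_norm_sqr.
    have toC (x y w : R) : (x + y - w *+ 2)%:C%C = x%:C%C + y%:C%C - 2 * w%:C%C :> C.
      by rewrite rmorphB rmorphD rmorphMn mulr_natl.
    rewrite toC !family_norm_sqr -addcJ.
    rewrite rmorph_sum -!big_split -sumrB; apply: eq_bigr => k _ /=.
    rewrite cdotBl !cdotBr (cdotC (be z k) (al z k)).
    by rewrite [(_ ^*)%C](_ : _ = (cdot (be z k) (al z k))^*) //; ring.
  have -> : \sum_k cdot (be z k) (al z k) =
      \sum_x cdot (xi x) (cdot (theta z) (phi x) *: (T x *m theta z)).
    rewrite -(pair_bigA _ (fun x j => cdot (be z (x, j)) (al z (x, j)))) /=.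
    apply: eq_bigr => x _; rewrite /be /al /=; under eq_bigr do rewrite cdotZl.
    rewrite -mulr_sumr sum_cdot_extend cdot0r add0r cdotZr.
    by rewrite -(cdotC (phi x) (theta z)).
  by rewrite al1 be1 Re_sum; have := xiT z; rewrite !expr1n; lra.
exists (fun e => vexp gam e *: 1%:M); first exact: constant_channel_vexp.
apply: delta_le => [|k a a1]; first by rewrite addr_ge0 ?sqrtr_ge0.
(* The pinched channel and the constant one are both diagonal in [theta], so each [z] can be
   estimated separately. *)
apply: (mxrep_onb_le (g := fun z e => vexp (al z) e - vexp gam e) htheta).
- move=> e; rewrite /= /pinching -(sum_projmx htheta) scaler_sumr -sumrB.
  apply: eq_bigr => z _; rewrite scalerBl vexp_al; congr (_ - _).
  exact: projmx_sandwich.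
- by rewrite mulr_ge0 // addr_ge0 ?sqrtr_ge0.
move=> z u v.
have -> : amplify (fun e => vexp (al z) e - vexp gam e) a u v =
    amplify (fun e => vexp (al z) e - vexp (be z) e) a u v +
    \sum_x (born phi theta x z - p x)%:C%C * amplify (vexp (xi' x)) a u v.
  apply: amplify_addsum => e.
  rewrite (eq_bigr (fun x => (born phi theta x z)%:C%C * vexp (xi' x) e -
    (p x)%:C%C * vexp (xi' x) e)) => [|x _]; last by rewrite rmorphB mulrBl.
  by rewrite sumrB -vexp_be -vexp_gam addrA subrK.
apply: le_trans (le_normcD _ _) _.
have uv0 : 0 <= l2norm u * l2norm v by rewrite mulr_ge0 ?l2norm_ge0.
(* The first term is the passage from [al] to [be], with 2 the sum of their norms; the second is the
   passage from the weights [born] to [p]. *)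
apply: (@le_trans _ _ (Num.sqrt (2 * eps) * 2 * (l2norm u * l2norm v) +
    2 * b * (l2norm u * l2norm v))); last first.
  by rewrite le_eqVlt; apply/orP; left; apply/eqP; ring.
apply: lerD.
  apply: le_trans (amplify_vexp_sub_le a1 (al z) (be z) u v) _.
  by rewrite al1 be1 ler_wpM2r // ler_wpM2r // close.
apply: le_trans (normc_sum _) _; apply: le_trans (ler_wpM2r uv0 (pb z)).
rewrite mulr_suml; apply: ler_sum => x _; rewrite normcM normc_real ler_wpM2l //.
by have := amplify_vexp_le a1 (xi' x) u v; rewrite xi'1 expr1n mul1r.
Qed.

End ConstantApproximation.

(** * From a good measurement on B to a nearly constant channel for E *)

Theorem corollary1 (R : realType) (d dB dE : nat) (XX ZZ : finType)
  (X Z : 'M[R[i]]_d) (phi : XX -> 'cV[R[i]]_d) (theta : ZZ -> 'cV[R[i]]_d)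
  (N : 'M[R[i]]_dB -> 'M[R[i]]_d) (Nc : 'M[R[i]]_dE -> 'M[R[i]]_d) (eps : R)
  (d_gt0 : (0 < d)%N)
  (hX : nondegenerate_eigenbasis X phi)
  (hZ : nondegenerate_eigenbasis Z theta)
  (hN : channel N)
  (hNc : complementary N Nc)
  (hLambda : exists Lambda : Linf R XX -> 'M[R[i]]_dB,
     channel Lambda /\
     (delta (ideal_measurement phi) (N \o Lambda) <= eps%:E)%E) :
  exists T : 'M[R[i]]_dE -> 'M[R[i]]_d,
    [/\ constant_channel T,
        (delta (pinching theta \o Nc) T <=
           (Num.sqrt (2 * eps)%R)%:E +
           ((d%:R - 1) / d%:R)%R%:E - complementarity_P phi theta)%E &
        maximally_complementary phi theta ->
        (delta (pinching theta \o Nc) T <= (Num.sqrt (2 * eps)%R)%:E)%E].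
Proof.
have [_ hphi _] := hX; have [_ htheta _] := hZ.
have [V [V1 NE NcE]] := hNc.
have [Lam [cLam Leps]] := hLambda.
have [A AE] := choice (fun x => psdmx_factor (psdmx_channel_indicator x cLam)).
pose T x : 'M[R[i]]_(dB * dE, d) := (A x *t (1%:M : 'M_dE)) *m V.
have TT x : (T x)^t* *m T x = N (Lam (indicator R x)).
  by rewrite NE AE -tensmx_sandwich tensmx1 mulmx1.
have [linLam Lam1 _] := cLam; have [linN N1 _] := hN.
have linNLam : linear (N \o Lam) by move=> c f g; rewrite /= linLam linN.
have EE f : (N \o Lam) f = \sum_x f x *: ((T x)^t* *m T x).
  rewrite (linear_indicator f linNLam); apply: eq_bigr => x _.
  by rewrite TT.
have T1 : \sum_x (T x)^t* *m T x = 1%:M.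
  transitivity ((N \o Lam) obs1); last by rewrite /= Lam1 N1.
  by rewrite EE; apply: eq_bigr => x _; rewrite ffunE scale1r.
have NcT e : Nc e = \sum_x (T x)^t* *m ((1%:M : 'M_dB) *t e) *m T x.
  (* The identity on B is split into the effects of the measurement. *)
  rewrite NcE (eq_bigr (fun x => V^t* *m ((A x)^t* *m A x *t e) *m V)) => [|x _].
    rewrite -mulmx_suml -mulmx_sumr; congr (_ *m _ *m _).
    rewrite -(sum_channel_indicator cLam).
    rewrite (eq_bigr (fun x => (A x)^t* *m A x)) => [|x _]; last exact: AE.
    apply/matrixP => i j; rewrite summxE [LHS]mxE summxE mulr_suml.
    by apply: eq_bigr => x _; rewrite [RHS]mxE.
  exact: tensmx_sandwich.
pose o := Ordinal d_gt0.
(* An isometry from a nonzero space cannot land in the zero space. *)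
have dE_gt0 : (0 < dE)%N.
  rewrite lt0n; apply/eqP => dE0; have /matrixP/(_ o o) := V1.
  rewrite !mxE eqxx big1 => [/eqP|i _]; first by rewrite eq_sym oner_eq0.
  have := ltn_ord i; rewrite [X in (_ < X)%N](_ : _ = 0%N) ?ltn0 //.
  by rewrite dE0 muln0.
pose w x z := cdot (theta z) (phi x) *: (T x *m theta z).
have [|xi xi1 xiw] := ball_minimax (w := w) (c := 1 - eps).
  move=> lam lam0; apply: le_trans (overlap_sum hphi htheta EE T1 Leps lam0) _.
  apply: ler_sum => x _; rewrite mulmx_sumr.
  rewrite (eq_bigr (fun z => (lam z)%:C%C *: w x z)) // => z _.
  by rewrite /w -scalemxAr scalerA.
pose inf := ereal_inf [set delta S (ideal_preparation theta \o ideal_measurement phi) |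
  S in [set S : Linf R XX -> Linf R ZZ | constant_channel S]].
have inf0 : (0 <= inf)%E.
  by apply: le_ereal_inf_tmp => _ [S _ <-]; exact: delta_ge0.
(* The term (d - 1) / d cancels against the one in c_P; the identity also covers an infimum equal to
   +oo. *)
have rhsE : ((Num.sqrt (2 * eps)%R)%:E + ((d%:R - 1) / d%:R)%R%:E
    - complementarity_P phi theta = (Num.sqrt (2 * eps)%R)%:E + inf)%E.
  rewrite /complementarity_P -/inf; move: inf0; case: inf => [c _|_|]; last by [].
    set a := (_ - 1) / _; set r := Num.sqrt _.
    change ((r + a - (a - c))%:E = (r + c)%:E); congr EFin; ring.
  by [].
have [z0 _] : exists z0 : ZZ, True.
  have [z0 _|noZ] := pickP (fun _ : ZZ => true); first by exists z0.
  have := onb_expand htheta (delta_mx o 0); rewrite big1 => [/colP/(_ o)|z]; last first.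
    by have := noZ z.
  by rewrite !mxE !eqxx => /eqP; rewrite oner_eq0.
(* One channel must meet both bounds. In the maximally complementary case [born] does not depend on
   [z], so [p] is taken to be its common row, at cost 0; the general bound follows as the infimum is
   nonnegative. *)
have [mc|nmc] := pselect (maximally_complementary phi theta).
  have [|S cS Sle] :=
    constant_channel_approx hphi htheta NcT T1 dE_gt0 xi1 xiw
      (born_distribution z0 hphi htheta) (lexx 0).
    move=> z; rewrite mulr0 big1 // => x _.
    have -> : born phi theta x z = born phi theta x z0; last by rewrite subrr normr0.
    by apply: complexI; rewrite [LHS]normc_sqr [RHS]normc_sqr -!normCKC !mc.
  exists S; rewrite addr0 in Sle; split=> //.
  by rewrite rhsE; apply: le_trans Sle _; rewrite leeDl.
case infE : inf inf0 => [c| |] // c0.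
  have [p dp ple] := best_distribution infE.
  have [S cS Sle] :=
    constant_channel_approx hphi htheta NcT T1 dE_gt0 xi1 xiw dp c0 ple.
  by exists S; split=> //; rewrite rhsE infE -EFinD.
(* With an infinite infimum the right side is +oo, so any distribution with a finite cost
   suffices. *)
pose p x := born phi theta x z0.
have dp : distribution p by exact: born_distribution.
have [||S cS Sle] := constant_channel_approx hphi htheta NcT T1 dE_gt0 xi1 xiw
  (b := \sum_z \sum_x `|born phi theta x z - p x|) dp.
- by apply: sumr_ge0 => z _; exact: sumr_ge0.
- move=> z; apply: (@le_trans _ _ (\sum_z \sum_x `|born phi theta x z - p x|)).
    by rewrite (bigD1 z) //= lerDl; apply: sumr_ge0 => z' _; exact: sumr_ge0.
  by rewrite ler_peMl ?ler1n //; apply: sumr_ge0 => z' _; exact: sumr_ge0.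
by exists S; split=> //; rewrite rhsE infE leey.
Qed.
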